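(* Let $\ell\ge2$, $m=\lfloor\ell/2\rfloor$, $a\in\mathfrak o_\ell^\times$, and let $\bar a$ be the image of $a$ in $\mathfrak o_m$. (1) An irreducible representation $\pi$ of $\mathbf G(\mathfrak o_\ell)$ admits a $\theta_a$-Whittaker model if and only if $\pi$ is $\bar a$-regular. (2) Every irreducible representation of $\mathbf G(\mathfrak o_\ell)$ admits at most one $\theta_a$-Whittaker model.
   Context: $\mathfrak o$: ring of integers of a non-archimedean local field, uniformizer $\varpi$, residue field $\mathbb F_q$ of characteristic $p$; $\mathfrak o_r=\mathfrak o/\varpi^r\mathfrak o$. Either $\mathbf G={\rm GL}_n$ (any $p$), $\mathfrak g=M_n$, or $\mathbf G={\rm SL}_n$ with $p$ odd and $p\nmid n$, $\mathfrak g=\mathfrak{sl}_n$ (trace zero). $\mathbf U(\mathfrak o_\ell)$: upper unitriangular matrices in $\mathbf G(\mathfrak o_\ell)$. Fix a primitive character $\varphi$ of $(\mathfrak o_\ell,+)$ (nontrivial on $\varpi^{\ell-1}\mathfrak o_\ell$), and define $\theta_a((u_{ij}))=\varphi(a u_{12}+u_{23}+\dots+u_{n-1,n})$. $\pi$ admits a $\theta_a$-Whittaker model if $\mathrm{Hom}_{\mathbf G(\mathfrak o_\ell)}(\pi,\mathrm{Ind}_{\mathbf U(\mathfrak o_\ell)}^{\mathbf G(\mathfrak o_\ell)}\theta_a)\ne0$, at most one if this has dimension $\le1$. For $1\le i<\ell$, $K_\ell^i=\ker(\mathbf G(\mathfrak o_\ell)\to\mathbf G(\mathfrak o_i))$;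 for $i\ge\ell/2$, each $x\in\mathfrak g(\mathfrak o_{\ell-i})$ gives a character $\varphi_x(I+\varpi^iy)=\varphi(\varpi^i\mathrm{tr}(\hat xy))$ of $K_\ell^i$, $\hat x$ any lift of $x$ to $\mathfrak g(\mathfrak o_\ell)$. $x\in\mathfrak g(\mathfrak o_r)$ is regular if some $v$ has $v,xv,\dots,x^{n-1}v$ an $\mathfrak o_r$-basis of $\mathfrak o_r^{\oplus n}$. An irreducible $\rho$ is regular if $\rho|_{K_\ell^{\ell-1}}$ contains $\varphi_x$ with $x\in\mathfrak g(\mathbb F_q)$ regular. For $\alpha\in\mathfrak o_r^\times$, an $\alpha$-regular element of $\mathfrak g(\mathfrak o_r)$ is a matrix with $(2,1)$ entry $\alpha$, entries $(i+1,i)$ equal to $1$ for $2\le i\le n-1$, arbitrary last column, and all other entries $0$. A regular representation $\rho$ of $\mathbf G(\mathfrak o_\ell)$ is $\alpha$-regular ($\alpha\in\mathfrak o_m^\times$) if $\rho|_{K_\ell^{\lceil\ell/2\rceil}}$ contains $\varphi_x$ for some $\alpha$-regular $x\in\mathfrak g(\mathfrak o_m)$. *)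

(* Defs.v *)
From HB Require Import structures.
From mathcomp Require Import all_boot all_order all_algebra all_fingroup all_solvable all_field all_character.
Set Implicit Arguments. Unset Strict Implicit. Unset Printing Implicit Defensive.
Import Order.TTheory GRing.Theory Num.Theory.
Local Open Scope ring_scope.

Definition dvr_uniformizer (o : idomainType) (w : o) : Prop :=
  [/\ w != 0, w \isn't a GRing.unit &
      forall x : o, x != 0 -> exists k : nat, exists2 u : o, u \is a GRing.unit & x = u * w ^+ k].

Section Ideals.
Variables (R : finComUnitRingType) (w : R).

(* z lies in w^r R  (i.e. z = 0 in o_r = R / w^r R) *)
Definition inI (r : nat) (z : R) : bool := [exists c : R, z == w ^+ r * c].

Definition unit_mod (r : nat) (z : R) : bool := [exists u : R, inI r (z * u - 1)].

Lemma inI0 r : inI r 0.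
Proof. by apply/existsP; exists 0; rewrite mulr0. Qed.

Lemma inID r x y : inI r x -> inI r y -> inI r (x + y).
Proof.
move=> /existsP[c /eqP->] /existsP[d /eqP->]; apply/existsP; exists (c + d).
by rewrite mulrDr.
Qed.

Lemma inIMl r x y : inI r y -> inI r (x * y).
Proof.
move=> /existsP[c /eqP->]; apply/existsP; exists (x * c).
by rewrite mulrCA.
Qed.

Lemma inIMr r x y : inI r x -> inI r (x * y).
Proof. by move=> h; rewrite mulrC inIMl. Qed.

Lemma inI_sum r (I : finType) (P : pred I) (F : I -> R) :
  (forall i, P i -> inI r (F i)) -> inI r (\sum_(i | P i) F i).
Proof.
move=> h; elim/big_rec: _ => [|i x Pi hx]; first exact: inI0.
by apply: inID => //; apply: h.
Qed.
End Ideals.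

Inductive GType := GLt | SLt.

Section Groups.
Variables (n : nat) (R : finComUnitRingType).
Local Notation GLn := {'GL_n[R]}.

Definition SLset : {set GLn} := [set g : GLn | \det (GLval g) == 1].

Lemma SL_group_set : group_set SLset.
Proof.
apply/group_setP; split; first by rewrite inE GL_1E det1.
by move=> x y; rewrite !inE GL_MxE det_mulmx => /eqP-> /eqP->; rewrite mulr1.
Qed.
Canonical SL_group := Group SL_group_set.

Definition Ggroup (t : GType) : {group GLn} :=
  if t is SLt then SL_group else [group of [set: GLn]].

(* g(o_l)-membership of a lift: for SL, trace zero *)
Definition in_g (t : GType) (x : 'M[R]_n.-1.+1) : bool :=
  if t is SLt then \tr x == 0 else true.

Definition unitri (M : 'M[R]_n.-1.+1) : bool :=
  [forall i : 'I_n.-1.+1, forall j : 'I_n.-1.+1, ((j < i)%N ==> (M i j == 0)) && ((i == j) ==> (M i j == 1))].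

Definition Uset : {set GLn} := [set g : GLn | unitri (GLval g)].

Lemma U_group_set : group_set Uset.
Proof.
apply/group_setP; split.
  rewrite inE GL_1E; apply/forallP=> i; apply/forallP=> j; rewrite !mxE.
  by case: (eqVneq i j) => [->|_]; rewrite ?ltnn ?eqxx //=; case: (_ < _)%N.
move=> x y; rewrite !inE => /forallP hx /forallP hy.
have Hx (i j : 'I_n.-1.+1) : (j < i)%N -> GLval x i j = 0.
  by move=> lt; move: (forallP (hx i) j) => /andP[/implyP/(_ lt)/eqP].
have Hy (i j : 'I_n.-1.+1) : (j < i)%N -> GLval y i j = 0.
  by move=> lt; move: (forallP (hy i) j) => /andP[/implyP/(_ lt)/eqP].
have Dx (i : 'I_n.-1.+1) : GLval x i i = 1 by move: (forallP (hx i) i) => /andP[_ /implyP/(_ (eqxx _))/eqP].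
have Dy (i : 'I_n.-1.+1) : GLval y i i = 1 by move: (forallP (hy i) i) => /andP[_ /implyP/(_ (eqxx _))/eqP].
apply/forallP=> i; apply/forallP=> j; rewrite GL_MxE !mxE; apply/andP; split.
  apply/implyP=> lt; apply/eqP; apply: big1 => k _.
  case: (ltnP k i) => [ki|ik]; first by rewrite Hx // mul0r.
  by rewrite Hy ?mulr0 // (leq_trans lt ik).
apply/implyP=> /eqP<-; apply/eqP; rewrite (bigD1 i) //= Dx Dy mulr1 big1 ?addr0 //.
move=> k nki; case: (ltngtP k i) => [ki|ik|/val_inj eki].
- by rewrite Hx // mul0r.
- by rewrite Hy ?mulr0.
- by rewrite eki eqxx in nki.
Qed.
Canonical U_group := Group U_group_set.

Variable w : R.

Definition mx_inI (i : nat) (M : 'M[R]_n.-1.+1) : bool :=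
  [forall r, forall c, inI w i (M r c)].

Definition Kerset (i : nat) : {set GLn} := [set g : GLn | mx_inI i (GLval g - 1)].

Lemma Ker_group_set i : group_set (Kerset i).
Proof.
apply/group_setP; split.
  by rewrite inE GL_1E subrr; apply/forallP=> r; apply/forallP=> c; rewrite mxE inI0.
move=> x y; rewrite !inE => /forallP hx /forallP hy.
have -> : GLval (x * y) - 1 =
    (GLval x - 1) *m (GLval y - 1) + (GLval x - 1) + (GLval y - 1).
  rewrite GL_MxE mulmxBl !mulmxBr !mul1mx !mulmx1.
  by rewrite addrAC subrK addrA subrK.
apply/forallP=> r; apply/forallP=> c; rewrite !mxE.
apply: inID; last by move: (forallP (hy r) c); rewrite !mxE.
apply: inID; last by move: (forallP (hx r) c); rewrite !mxE.
apply: inI_sum => k _; apply: inIMr.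
by move: (forallP (hx r) k); rewrite !mxE.
Qed.
Canonical Ker_group i := Group (Ker_group_set i).

(* K_l^i = ker(G(o_l) -> G(o_i)) *)
Definition Kgroup (t : GType) (i : nat) : {group GLn} :=
  (Ggroup t :&: Ker_group i)%G.
End Groups.

(* The class function on H given by f (restricted to H); it is 0 if
   f restricted to H is not a class function (never the case below). *)
Definition mkCF (gT : finGroupType) (H : {group gT}) (f : gT -> algC) : 'CF(H) :=
  match @idP (is_class_fun <<H>>%g [ffun x => if x \in H then f x else 0]) with
  | ReflectT p => Cfun 0 p
  | ReflectF _ => 0
  end.

Section Chars.
Variables (n : nat) (R : finComUnitRingType) (w : R) (phi : R -> algC).
Local Notation GLn := {'GL_n[R]}.

Definition additive_char : Prop := phi 0 = 1 /\ forall x y, phi (x + y) = phi x * phi y.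

Definition primitive_char (l : nat) : Prop :=
  exists2 z, inI w l.-1 z & phi z != 1.

(* theta_a(u) = phi(a u_12 + u_23 + ... + u_{n-1,n})  (0-based indices) *)
Definition theta_fun (a : R) (u : GLn) : algC :=
  phi (a * GLval u ord0 (inord 1) +
       \sum_(1 <= k < n.-1) GLval u (inord k) (inord k.+1)).

Definition theta (a : R) : 'CF(@U_group n R) := mkCF (@U_group n R) (theta_fun a).

(* phi_x(I + w^i y) = phi(w^i tr(xhat y)) = phi(tr(xhat (g - 1))) *)
Definition phix_fun (xhat : 'M[R]_n.-1.+1) (g : GLn) : algC :=
  phi (\tr (xhat *m (GLval g - 1))).

Definition phix (t : GType) (i : nat) (xhat : 'M[R]_n.-1.+1) : 'CF(@Kgroup n R w t i) :=
  mkCF (@Kgroup n R w t i) (phix_fun xhat).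

(* x (mod w^r) is regular: some v with v, xv, ..., x^{n-1}v an o_r-basis of
   o_r^n, i.e. the matrix with these columns is invertible over o_r *)
Definition regular_mod (r : nat) (x : 'M[R]_n.-1.+1) : Prop :=
  exists v : 'cV[R]_n.-1.+1,
    unit_mod w r (\det (\matrix_(i, k) ((x ^+ k) *m v) i ord0)).

(* x (mod w^r) is alpha-regular, alpha = image of a: (2,1) entry alpha,
   (i+1,i) entries 1 for 2 <= i <= n-1, last column arbitrary, others 0 *)
Definition alpha_regular_mod (r : nat) (a : R) (x : 'M[R]_n.-1.+1) : bool :=
  [forall i : 'I_n.-1.+1, forall j : 'I_n.-1.+1, (j < n.-1)%N ==>
     inI w r (x i j - (if (i == 1%N :> nat) && (j == 0%N :> nat) then a
                       else if ((1 <= j)%N && (i == j.+1 :> nat)) then 1 else 0))].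

Definition contains_phix (t : GType) (i : nat) (chi : 'CF(@Ggroup n R t))
  (xhat : 'M[R]_n.-1.+1) : Prop :=
  '['Res[@Kgroup n R w t i] chi, phix t i xhat] != 0.

Definition regular_rep (t : GType) (l : nat) (chi : 'CF(@Ggroup n R t)) : Prop :=
  exists xhat : 'M[R]_n.-1.+1,
    [/\ @in_g n R t xhat, regular_mod 1 xhat & @contains_phix t l.-1 chi xhat].

Definition alpha_regular_rep (t : GType) (l : nat) (a : R) (chi : 'CF(@Ggroup n R t)) : Prop :=
  @regular_rep t l chi /\
  exists xhat : 'M[R]_n.-1.+1,
    [/\ @in_g n R t xhat, alpha_regular_mod l./2 a xhat &
        @contains_phix t (l - l./2) chi xhat].
End Chars.

(* Main.v *)
Require Import Defs.
From HB Require Import structures.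
From mathcomp Require Import all_boot all_order all_algebra all_fingroup all_solvable all_field all_character.
From mathcomp Require Import ring zify.
Set Implicit Arguments.
Unset Strict Implicit.
Unset Printing Implicit Defensive.
Import Order.TTheory GRing.Theory Num.Theory.
Local Open Scope ring_scope.

(* Write m = l / 2 (rounded down), m' = l - m and A = K^{m'}, let theta be
   theta_1 (conjugation by diag(1, a, ..., a) reduces to a = 1), and, for an
   irreducible chi, let k(x) be the multiplicity of phi_x in the restriction of
   chi to A.

   The characters phi_y of A extending theta on the intersection of A and U are
   those with y upper Hessenberg with unit subdiagonal, and every such y is
   u x u^-1 for a unique unipotent u and companion matrix x.  For u in U
   outside A, the sum of theta(v)^-1 chi(u v) over v in the intersection of U
   and A vanishes, because a nonzero nilpotent upper triangular matrix never
   commutes with y.  Hence the multiplicity of theta in chi is a multiple of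
   the sum of k(x) over all companion matrices x.  As conjugate companion
   matrices coincide, at most one x modulo w^m contributes, and the
   multiplicity equals k(x) / d for an explicit power d of the residue
   cardinality.

   It remains to see that k(x) <= d.  Mackey's formula gives that the sum of
   k(x)^2 over all chi is |S| / |A|, where S is the stabiliser of phi_x.  Let s
   be a symmetric matrix with x s symmetric, and tau(g) = s g^T s^-1, an
   anti-involution.  The twisted Frobenius-Schur indicators of tau have modulus
   at most 1, so the sum of k(x) is at least the number of tau-stable cosets of
   A in S, which is at least |S| / (|A| d).  As each nonzero k(x) is at least d,
   comparing the two sums forces k(x) to be 0 or d.

   For SL_n, one replaces the group by its product with the scalars congruent
   to 1 modulo w, that is by the matrices of determinant congruent to 1. *)

(** * Induced characters and twisted Frobenius-Schur indicators *)

Section LinearCharacters.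
Variables (gT : finGroupType) (H : {group gT}) (f : gT -> algC).
Hypothesis f1 : f 1%g = 1.
Hypothesis fM : {in H &, forall x y, f (x * y)%g = f x * f y}.

(** The values of [f] commute, so [f] is invariant under conjugation by [H] and the default value 0
    of [mkCF] does not occur. *)
Lemma mkCFE x : mkCF H f x = if x \in H then f x else 0.
Proof.
rewrite /mkCF; case: {-}_ / idP => [p|[]]; first by rewrite cfunE.
rewrite genGid; apply: intro_class_fun => [y z Hy Hz|y /negbTE-> //].
rewrite groupJr // Hy conjgE !fM ?groupM ?groupV // mulrCA -fM ?groupV //.
by rewrite mulVg f1 mulr1.
Qed.

Lemma mkCF_lin_char : mkCF H f \is a linear_char.
Proof.
have repr_f : mx_repr H (fun x => (f x)%:M : 'M[algC]_1).
  by split=> [|x y Hx Hy]; rewrite ?f1 // fM // -scalar_mxM.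
rewrite qualifE /= /linear_char_pred mkCFE group1 f1 eqxx andbT.
suff -> : mkCF H f = cfRepr (MxRepresentation repr_f) by apply: cfRepr_char.
apply/cfun_inP => x Hx; rewrite mkCFE cfunE Hx /= mulr1n.
by rewrite mxtrace_scalar mulr1n.
Qed.
End LinearCharacters.

Section InducedProducts.
Variable gT : finGroupType.
Implicit Types G A : {group gT}.

(** Mackey's formula for a normal subgroup: Frobenius reciprocity, then the sum over [G] that
    defines an induced character. *)
Lemma cfdot_Ind_normal G A (phi psi : 'CF(A)) : (A <| G)%g ->
  '['Ind[G] phi, 'Ind[G] psi] =
    #|A|%:R^-1 * \sum_(g in G) '[phi ^ g^-1, psi]%CF.
Proof.
case/andP=> sAG nAG; rewrite -cfdot_Res_l cfdotE /=.
under eq_bigr => x Ax.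
  rewrite cfResE // cfIndE // -mulrA mulr_suml; over.
rewrite -mulr_sumr exchange_big /=; congr (_ * _); rewrite mulr_sumr.
apply: eq_bigr => g Gg; rewrite cfdotE; congr (_ * _); apply: eq_bigr => x Ax.
by rewrite cfConjgE ?invgK // groupV (subsetP nAG).
Qed.

Lemma cfdot_lin_char A (phi psi : 'CF(A)) :
  phi \is a linear_char -> psi \is a linear_char -> '[phi, psi] = (phi == psi)%:R.
Proof.
move=> /lin_char_irr/irrP[i ->] /lin_char_irr/irrP[j ->].
by rewrite cfdot_irr (inj_eq irr_inj).
Qed.

Lemma cfConjg_lin_char A (phi : 'CF(A)) g :
  phi \is a linear_char -> (phi ^ g)%CF \is a linear_char.
Proof. by move=> /andP[phi_char phi1]; rewrite qualifE /= /linear_char_pred cfConjg_char // cfConjg1. Qed.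

(** By Schur's lemma the sum [M] over the conjugates of [v] acts as a scalar, which its trace
    determines. *)
Lemma irr_mul_avg G (i : Iirr G) u v : u \in G -> v \in G ->
  \sum_(t in G) 'chi_i (u * v ^ t^-1)%g = #|G|%:R / 'chi_i 1%g * ('chi_i u * 'chi_i v).
Proof.
move=> Gu Gv; set rG := 'Chi_i.
have trE x : x \in G -> 'chi_i x = \tr (rG x).
  by move=> Gx; rewrite -irrRepr cfunE Gx mulr1n.
have d_neq0 : 'chi_i 1%g != 0 by rewrite irr1_neq0.
pose M := \sum_(t in G) rG (v ^ t^-1)%g.
have /is_scalar_mxP[c cM] : is_scalar_mx M.
  apply: (mx_abs_irr_cent_scalar (rG:=rG)); first exact/groupC/socle_irr.
  apply/centgmxP => x Gx; rewrite mulmx_suml mulmx_sumr.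
  rewrite (reindex_inj (mulgI x)) /=; apply: eq_big => [t|t Gt].
    by rewrite groupMl.
  rewrite -!repr_mxM ?groupJ ?groupV //.
    by congr (rG _); rewrite invMg conjgM [(_ ^ x^-1)%g]conjgE invgK !mulgA mulgKV.
  by rewrite -(groupMl _ Gx).
have trM : c * 'chi_i 1%g = #|G|%:R * 'chi_i v.
  rewrite irr1_degree -mxtrace1 -mxtraceZ scalemx1 -cM linear_sum /=.
  rewrite (eq_bigr (fun _ => 'chi_i v)) ?sumr_const ?mulr_natl // => t Gt.
  by rewrite -trE ?groupJ ?groupV // cfunJ ?groupV.
transitivity (\tr (rG u *m M)).
  rewrite mulmx_sumr linear_sum /=; apply: eq_bigr => t Gt.
  by rewrite -repr_mxM ?groupJ ?groupV // trE // groupM // groupJ ?groupV.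
rewrite cM mul_mx_scalar mxtraceZ -trE //.
by apply: (mulIf d_neq0); rewrite mulrAC trM; field.
Qed.
End InducedProducts.

(* The inner product of [tau_count] with an irreducible character is its
   twisted Frobenius-Schur indicator. *)
Section TwistedIndicator.
Variables (gT : finGroupType) (G : {group gT}) (tau : gT -> gT).
Hypothesis tauM : forall g h, tau (g * h)%g = (tau h * tau g)%g.
Hypothesis tauK : involutive tau.
Hypothesis tauG : {in G, forall g, tau g \in G}.

Lemma tau1 : tau 1%g = 1%g.
Proof. by apply: (mulgI (tau 1%g)); rewrite -tauM !mulg1. Qed.

Lemma tauV g : tau g^-1%g = (tau g)^-1%g.
Proof. by apply: (mulgI (tau g)); rewrite -tauM mulVg tau1 mulgV. Qed.

Lemma tau_in g : (tau g \in G) = (g \in G).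
Proof. by apply/idP/idP => [/tauG|/tauG //]; rewrite tauK. Qed.

Definition tau_count : 'CF(G) :=
  mkCF G (fun a => \sum_(g in G) (g * (tau g)^-1 == a)%g%:R).

(** Replacing [g] by [z^-1 * g * (tau z)^-1] conjugates [g * (tau g)^-1] by [z], so the count is a
    class function. *)
Lemma tau_countE a : a \in G ->
  tau_count a = \sum_(g in G) (g * (tau g)^-1 == a)%g%:R.
Proof.
move=> Ga; rewrite /tau_count /mkCF; case: {-}_ / idP => [p|[]]; first by rewrite cfunE Ga.
rewrite genGid; apply: intro_class_fun => [y z Gy Gz|y /negbTE-> //].
rewrite groupJr // Gy (reindex_inj (mulgI z^-1)%g) (reindex_inj (mulIg (tau z)^-1)%g) /=.
apply: eq_big => [g|g Gg].
  by rewrite groupMl ?groupMr ?groupV ?tauG.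
rewrite !tauM !tauV tauK !invMg !invgK !mulgA mulgKV -!mulgA conjgE.
by rewrite (inj_eq (mulgI _)) !mulgA (inj_eq (mulIg _)).
Qed.

Lemma cfdot_tau_count (phi : 'CF(G)) :
  '[phi, tau_count] = #|G|%:R^-1 * \sum_(g in G) phi (g * (tau g)^-1)%g.
Proof.
rewrite cfdotE; congr (_ * _).
under eq_bigr => a Ga do rewrite tau_countE // rmorph_sum mulr_sumr.
rewrite exchange_big /=; apply: eq_bigr => g Gg.
have Gtg: (g * (tau g)^-1)%g \in G by rewrite groupM ?groupV ?tauG.
rewrite (bigD1 _ Gtg) /= eqxx conjC_nat mulr1 big1 ?addr0 // => a /andP[_].
by rewrite eq_sym => /negbTE->; rewrite conjC_nat mulr0.
Qed.

(** Two uses of [irr_mul_avg]: one merges a product of two values of ['chi_i] into a single value,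
    the other splits the result into ['chi_i p] and the conjugate of ['chi_i (tau p)]. *)
Lemma cfdot_tau_count_sqr (i : Iirr G) :
  '['chi_i, tau_count] ^+ 2 = #|G|%:R^-1 * \sum_(p in G) 'chi_i p * ('chi_i (tau p))^*.
Proof.
set chi := 'chi_i; set nG : algC := #|G|%:R.
have nG0 : nG != 0 by rewrite neq0CG.
have d0 : chi 1%g != 0 by rewrite irr1_neq0.
pose q g := (g * (tau g)^-1)%g.
have Gq g : g \in G -> q g \in G by move=> Gg; rewrite groupM ?groupV ?tauG.
have -> : '[chi, tau_count] ^+ 2 =
    nG^-1 ^+ 2 * \sum_(g in G) \sum_(h in G) chi (q g) * chi (q h).
  rewrite cfdot_tau_count exprMn; congr (_ * _).
  by rewrite expr2 mulr_suml; apply: eq_bigr => g _; rewrite mulr_sumr.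
have -> : \sum_(g in G) \sum_(h in G) chi (q g) * chi (q h) =
    chi 1%g * \sum_(g in G) \sum_(h in G) chi (q g * q h)%g.
  rewrite mulr_sumr; apply: eq_bigr => g Gg.
  transitivity (chi 1%g / nG * \sum_(h in G) \sum_(t in G) chi (q g * q h ^ t^-1)%g).
    rewrite mulr_sumr; apply: eq_bigr => h Gh.
    by rewrite irr_mul_avg ?Gq // -/chi -/nG; field; rewrite nG0 d0.
  rewrite exchange_big /= -!mulrA; congr (_ * _).
  transitivity (nG^-1 * \sum_(t in G) \sum_(h in G) chi (q g * q h)%g); last first.
    by rewrite sumr_const -[X in _ * X]mulr_natl mulKf.
  congr (_ * _); apply: eq_bigr => t Gt.
  (* Since [q (t * h * tau t)] equals [q h ^ t^-1], the conjugation by [t] disappears from the sum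
     over [h]. *)
  rewrite [RHS](reindex_inj (mulgI t)) (reindex_inj (mulIg (tau t))) /=.
  apply: eq_big => [h|h Gh]; first by rewrite groupMl ?groupMr ?tauG.
  congr (chi (_ * _)%g); rewrite /q !tauM tauK !invMg conjgE invgK.
  by rewrite !mulgA mulgK.
have -> : \sum_(g in G) \sum_(h in G) chi (q g * q h)%g =
    \sum_(p in G) \sum_(t in G) chi (p * ((tau p)^-1 ^ t^-1))%g.
  (* With [h = (tau p)^-1 * tau g] and [t = (tau g)^-1], the arguments of [chi] on both sides are
     conjugate under [p * g^-1]. *)
  rewrite [RHS]exchange_big [RHS](reindex_inj (inj_comp invg_inj (can_inj tauK))) /=.
  apply: eq_big => [g|g Gg]; first by rewrite groupV tau_in.
  rewrite (reindex_inj (mulIg (tau g))) (reindex_inj (inj_comp invg_inj (can_inj tauK))) /=.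
  apply: eq_big => [p|p Gp]; first by rewrite groupMr ?tauG // groupV tau_in.
  have Gtg : tau g \in G by rewrite tauG.
  have {}Gp : p \in G by move: Gp; rewrite groupMr // groupV tau_in.
  rewrite -[RHS](@cfunJ _ _ _ _ (p * g^-1)%g) ?groupM ?groupV //.
  congr (chi _); rewrite /q !tauM !tauV !tauK !conjgE !invMg !invgK.
  by rewrite !mulgA mulgKV.
rewrite (eq_bigr (fun p => nG / chi 1%g * (chi p * (chi (tau p))^*))) => [|p Gp].
  by rewrite -mulr_sumr; field; rewrite nG0 d0.
by rewrite irr_mul_avg ?groupV ?tauG // irr_inv.
Qed.

(** Both ['chi_i] and its composite with [tau] have norm 1; the bound is Cauchy-Schwarz, through
    |xy| <= (|x|^2 + |y|^2) / 2. *)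
Lemma norm_cfdot_tau_count (i : Iirr G) : `|'['chi_i, tau_count]| <= 1.
Proof.
rewrite -(@ler_pXn2r _ 2) ?nnegrE ?normr_ge0 // expr1n -normrX cfdot_tau_count_sqr.
have norm1 : #|G|%:R^-1 * \sum_(p in G) `|'chi_i p| ^+ 2 = 1.
  rewrite -[RHS](cfnorm_irr i) cfdotE; congr (_ * _).
  by apply: eq_bigr => p _; rewrite normCK.
have norm2 : #|G|%:R^-1 * \sum_(p in G) `|'chi_i (tau p)| ^+ 2 = 1.
  by rewrite -[RHS]norm1 [in RHS](reindex_inj (can_inj tauK)); under [in RHS]eq_bigl do rewrite tau_in.
have nG0 : 0 <= #|G|%:R^-1 :> algC by rewrite invr_ge0 ler0n.
rewrite normrM ger0_norm //.
apply: (@le_trans _ _ (#|G|%:R^-1 * \sum_(p in G)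
    (`|'chi_i p| ^+ 2 + `|'chi_i (tau p)| ^+ 2) / 2%:R)).
  apply: ler_wpM2l => //; apply: le_trans (ler_norm_sum _ _ _) _.
  apply: ler_sum => p Gp; rewrite normrM norm_conjC.
  rewrite ler_pdivlMr ?ltr0n // -subr_ge0.
  rewrite (_ : _ - _ = (`|'chi_i p| - `|'chi_i (tau p)|) ^+ 2); last by ring.
  by rewrite real_exprn_even_ge0 // rpredB ?normr_real.
by rewrite -mulr_suml mulrA big_split mulrDr norm1 norm2 -mulr2n divff ?pnatr_eq0.
Qed.
End TwistedIndicator.

(** * Finite chain rings *)

(** An abstraction of the quotient of o by the l-th power of the uniformizer: a finite local
    principal ideal ring whose maximal ideal has nilpotency index exactly [l]. *)
Record chain_ring (R : finComUnitRingType) (w : R) (l : nat) : Prop := ChainRing {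
  chain_gt1 : (1 < l)%N;
  chain_nil : w ^+ l = 0;
  chain_top : w ^+ l.-1 != 0;
  chain_factor : forall x : R, x != 0 ->
    exists k : nat, exists2 u : R, u \is a GRing.unit & x = u * w ^+ k }.

Lemma geometric_inverse (A : pzRingType) (y : A) l :
  y ^+ l = 0 -> (1 - y) * (\sum_(i < l) y ^+ i) = 1.
Proof. by move=> yl; rewrite -opprB mulNr -subrX1 yl sub0r opprK. Qed.

Section ChainRings.
Variables (R : finComUnitRingType) (w : R) (l : nat).
Hypothesis cR : chain_ring w l.

Let wl : w ^+ l = 0 := chain_nil cR.

Lemma chain_wgeq0 k : (l <= k)%N -> w ^+ k = 0.
Proof. by move=> /subnK<-; rewrite exprD wl mulr0. Qed.

Lemma chain_wlt_neq0 k : (k < l)%N -> w ^+ k != 0.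
Proof.
move=> kl; apply: contra_neq (chain_top cR) => wk0.
by rewrite -(@subnK k l.-1) ?exprD ?wk0 ?mulr0 //; lia.
Qed.

Lemma chain_factor_lt x : x != 0 ->
  exists k, [/\ (k < l)%N & exists2 u : R, u \is a GRing.unit & x = u * w ^+ k].
Proof.
move=> x0; have [k [u uU xE]] := chain_factor cR x0; exists k; split; last by exists u.
by rewrite ltnNge; apply: contra x0 => /chain_wgeq0 wk0; rewrite xE wk0 mulr0.
Qed.

(** Turns a congruence modulo w^i into an equation in [R], to which linear algebra applies. If z is
    a unit times w^k, the equation forces k >= i. *)
Lemma inI_annE i z : (i <= l)%N -> inI w i z = (w ^+ (l - i) * z == 0).
Proof.
move=> il; apply/existsP/eqP => [[c /eqP->]|].
  by rewrite mulrA -exprD subnK // wl mul0r.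
have [->|z0] := eqVneq z 0; first by exists 0; rewrite mulr0.
have [k [kl [u uU ->]]] := chain_factor_lt z0.
rewrite mulrCA -exprD => uw; have [ki|ki] := leqP i k.
  by exists (u * w ^+ (k - i)); rewrite mulrCA -exprD subnKC.
have /negP[] := @chain_wlt_neq0 (l - i + k) ltac:(lia).
by apply/eqP; apply: (mulrI uU); rewrite uw mulr0.
Qed.

Lemma chain_unit1 x : inI w 1 (x - 1) -> x \is a GRing.unit.
Proof.
case/existsP=> c /eqP/(canRL (subrK 1)) ->; rewrite addrC -[X in 1 + X]opprK.
apply/unitrPr; exists (\sum_(i < l) (- (w ^+ 1 * c)) ^+ i).
by apply: geometric_inverse; rewrite exprNn exprMn expr1 wl mul0r mulr0.
Qed.
End ChainRings.

Section ChainMatrices.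
Variables (R : finComUnitRingType) (w : R) (l n : nat).
Hypothesis cR : chain_ring w l.
Local Notation n' := n.-1.+1.
Implicit Types M N : 'M[R]_n'.

Lemma mx_inIP i M : reflect (exists N, M = w ^+ i *: N) (mx_inI w i M).
Proof.
apply: (iffP forallP) => [h|[N ->] r].
  have c r k : {c | M r k == w ^+ i * c}.
    by apply: sigW; have /forallP/(_ k)/existsP[c hc] := h r; exists c.
  exists (\matrix_(r, k) sval (c r k)); apply/matrixP => r k; rewrite !mxE.
  by apply/eqP; apply: svalP (c r k).
by apply/forallP => k; rewrite mxE; apply/existsP; exists (N r k).
Qed.

Lemma mx_inI_annE i M : (i <= l)%N -> mx_inI w i M = (w ^+ (l - i) *: M == 0).
Proof.
move=> il; apply/forallP/eqP => [h|h r].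
  apply/matrixP => r k; rewrite !mxE; apply/eqP.
  by rewrite -(inI_annE cR) //; apply: forallP (h r) k.
by apply/forallP => k; rewrite (inI_annE cR) //; move/matrixP/(_ r k): h; rewrite !mxE => /eqP.
Qed.

Lemma mx_inID i M N : mx_inI w i M -> mx_inI w i N -> mx_inI w i (M + N).
Proof. by move=> /mx_inIP[M' ->] /mx_inIP[N' ->]; apply/mx_inIP; exists (M' + N'); rewrite scalerDr. Qed.

Lemma mx_inIN i M : mx_inI w i (- M) = mx_inI w i M.
Proof.
suff h N : mx_inI w i N -> mx_inI w i (- N) by apply/idP/idP => /h; rewrite ?opprK.
by move=> /mx_inIP[N' ->]; apply/mx_inIP; exists (- N'); rewrite scalerN.
Qed.

Lemma mx_inIB i M N : mx_inI w i M -> mx_inI w i N -> mx_inI w i (M - N).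
Proof. by move=> hM hN; rewrite mx_inID ?mx_inIN. Qed.

Lemma mx_inIMl i M N : mx_inI w i N -> mx_inI w i (M *m N).
Proof. by move=> /mx_inIP[N' ->]; apply/mx_inIP; exists (M *m N'); rewrite -scalemxAr. Qed.

Lemma mx_inIMr i M N : mx_inI w i M -> mx_inI w i (M *m N).
Proof. by move=> /mx_inIP[N' ->]; apply/mx_inIP; exists (N' *m N); rewrite -scalemxAl. Qed.

Lemma mx_inI_tr i M : mx_inI w i M^T = mx_inI w i M.
Proof.
suff h N : mx_inI w i N -> mx_inI w i N^T by apply/idP/idP => /h; rewrite ?trmxK.
by move=> /mx_inIP[N' ->]; apply/mx_inIP; exists N'^T; rewrite linearZ.
Qed.

Lemma mx_inI_leq i j M : (i <= j)%N -> mx_inI w j M -> mx_inI w i M.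
Proof.
by move=> ij /mx_inIP[N ->]; apply/mx_inIP; exists (w ^+ (j - i) *: N); rewrite scalerA -exprD subnKC.
Qed.

Lemma mx_inIM_eq0 i j M N : (l <= i + j)%N -> mx_inI w i M -> mx_inI w j N -> M *m N = 0.
Proof.
move=> lij /mx_inIP[M' ->] /mx_inIP[N' ->].
by rewrite -scalemxAl -scalemxAr scalerA -exprD (chain_wgeq0 cR lij) scale0r.
Qed.

Lemma mx_inI1_unit M : mx_inI w 1 (M - 1) -> M \is a GRing.unit.
Proof.
case/mx_inIP=> N /(canRL (subrK 1)) ->; rewrite addrC -[X in 1 + X]opprK.
have /geometric_inverse/mulmx1_unit[//] : (- (w ^+ 1 *: N)) ^+ l = 0.
by rewrite exprNn exprZn expr1 (chain_nil cR) scale0r mulr0.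
Qed.
End ChainMatrices.

Lemma mxtrace_mul_delta (R : pzRingType) n (M : 'M[R]_n) i j :
  \tr (M *m delta_mx j i) = M i j.
Proof.
rewrite /mxtrace (bigD1 i) //= big1 ?addr0 => [|k ki].
  rewrite mxE (bigD1 j) //= big1 ?addr0 => [|k kj]; first by rewrite mxE !eqxx mulr1.
  by rewrite mxE (negPf kj) mulr0.
by rewrite mxE big1 // => k' _; rewrite mxE (negPf ki) andbF mulr0.
Qed.

(** * Nondegeneracy of a primitive additive character *)

Section AdditiveCharacters.
Variables (R : finComUnitRingType) (w : R) (l : nat) (phi : R -> algC).
Hypotheses (cR : chain_ring w l) (phi_add : additive_char phi) (phi_prim : primitive_char w phi l).

Lemma phi0 : phi 0 = 1. Proof. by case: phi_add. Qed.
Lemma phiD x y : phi (x + y) = phi x * phi y. Proof. by case: phi_add. Qed.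

Lemma phiMn x k : phi (x *+ k) = phi x ^+ k.
Proof. by elim: k => [|k IH]; rewrite ?phi0 // mulrS phiD IH exprS. Qed.

Lemma phiNK x : phi (- x) * phi x = 1.
Proof. by rewrite -phiD addNr phi0. Qed.

Lemma phi_neq0 x : phi x != 0.
Proof. by apply: contra_eq_neq (phiNK x) => ->; rewrite mulr0 eq_sym oner_neq0. Qed.

Lemma phiN x : phi (- x) = (phi x)^-1.
Proof. by apply: (mulIf (phi_neq0 x)); rewrite phiNK mulVf ?phi_neq0. Qed.

Lemma norm_phi x : `|phi x| = 1.
Proof.
have h : phi x ^+ #|{: R}| = 1.
  by rewrite -phiMn -cardsT -FinRing.zmodXgE expg_cardG ?in_setT ?phi0.
apply/eqP; rewrite -(@pexpr_eq1 _ _ #|{: R}|) // -?normrX ?h ?normr1 //.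
by apply/card_gt0P; exists 0.
Qed.

Lemma phi_nondeg s : s != 0 -> exists r, phi (r * s) != 1.
Proof.
case: phi_prim => z /existsP[c /eqP->] phi_z /(chain_factor_lt cR)[k [kl [u uU ->]]].
(* This factor carries [u * w ^+ k] to the element [w ^+ l.-1 * c], on which [phi] is nontrivial. *)
exists (u^-1 * c * w ^+ (l.-1 - k)).
rewrite (_ : _ * _ = w ^+ l.-1 * c) // -[in RHS](@subnK k l.-1); last by lia.
by rewrite exprD -[RHS]mul1r -(mulVr uU); ring.
Qed.

Lemma phi_tr_nondeg n (M : 'M[R]_n) : M != 0 -> exists t, phi (\tr (M *m t)) != 1.
Proof.
move=> M0; have [[i j] /= Mij] : exists ij, M ij.1 ij.2 != 0.
  apply/existsP; apply: contraNT M0 => /existsPn h; apply/eqP/matrixP => i j.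
  by rewrite mxE; apply/eqP; have := h (i, j); rewrite negbK.
have [r phi_r] := phi_nondeg Mij; exists (r *: delta_mx j i).
by rewrite -scalemxAr mxtraceZ mxtrace_mul_delta.
Qed.

End AdditiveCharacters.

(** * Counting matrices and ideals *)

Lemma card_mx_family (R : finType) p q (S : 'I_p -> 'I_q -> {set R}) :
  #|[set M : 'M[R]_(p, q) | [forall i, forall j, M i j \in S i j]]| =
  (\prod_i \prod_j #|S i j|)%N.
Proof.
pose F (ij : 'I_p * 'I_q) := mem (S ij.1 ij.2).
pose toM (f : {ffun 'I_p * 'I_q -> R}) : 'M[R]_(p, q) := \matrix_(i, j) f (i, j).
have toM_inj : injective toM.
  move=> f g /matrixP fg; apply/ffunP => -[i j].
  by have := fg i j; rewrite !mxE.
transitivity #|toM @: [set f in family F]|.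
  apply: eq_card => M; rewrite inE; apply/forallP/imsetP => [h|[f]].
    exists [ffun ij => M ij.1 ij.2]; last by apply/matrixP => i j; rewrite mxE ffunE.
    by rewrite inE; apply/familyP => -[i j]; rewrite ffunE; apply: forallP (h i) j.
  rewrite inE => /familyP fF -> i; apply/forallP => j; rewrite mxE.
  exact: (fF (i, j)).
rewrite card_imset // cardsE card_family foldrE big_map big_enum /=.
by rewrite pair_big /=; apply: eq_big => // ij _.
Qed.

Section IdealCards.
Variables (R : finComUnitRingType) (w : R) (l : nat).
Hypothesis cR : chain_ring w l.

Definition ideal i : {set R} := [set x | inI w i x].

Lemma card_ideal0 : #|ideal 0| = #|{: R}|.
Proof.
rewrite -cardsT; apply: eq_card => x; rewrite !inE; apply/existsP.
by exists x; rewrite expr0 mul1r.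
Qed.

(** The fibres of multiplication by w^i, whose image is [ideal i], are cosets of its kernel
    [ideal (l - i)]. *)
Lemma card_ideal_mul i : (i <= l)%N -> (#|ideal i| * #|ideal (l - i)|)%N = #|{: R}|.
Proof.
move=> il; rewrite -[RHS]cardsT -[RHS]sum1_card [RHS](partition_big (fun x => w ^+ i * x) (mem (ideal i))) /=; last first.
  by move=> x _; rewrite inE; apply/existsP; exists x.
rewrite -sum_nat_const; apply: eq_bigr => _ /[1!inE] /existsP[x /eqP->].
rewrite sum1_card -(card_imset _ (addrI x)); apply: eq_card => y.
apply/imsetP/idP => [[z /[1!inE] zI ->]|].
  move: zI; rewrite (inI_annE cR) ?leq_subr // subKn // => /eqP zI.
  by rewrite unfold_in /= in_setT mulrDr zI addr0 eqxx.
rewrite unfold_in /= in_setT => /eqP yx; exists (y - x); last by rewrite addrC subrK.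
by rewrite inE (inI_annE cR) ?leq_subr // subKn // mulrBr yx subrr.
Qed.

Lemma card_ideal_gt0 i : (0 < #|ideal i|)%N.
Proof. by apply/card_gt0P; exists 0; rewrite inE inI0. Qed.
End IdealCards.

(** * Hessenberg and companion matrices *)

Section Hessenberg.
Variables (R : comUnitRingType) (N : nat).
Implicit Types (M y u : 'M[R]_N.+1) (c : 'cV[R]_N.+1).

Definition unitriangular u := forall i j : 'I_N.+1, (j <= i)%N -> u i j = (i == j)%:R.

Definition hessenberg y := forall i j : 'I_N.+1, (j < i)%N -> y i j = (i == j.+1 :> nat)%:R.

Definition companion c : 'M[R]_N.+1 :=
  \matrix_(i, j) if j == ord_max then c i 0 else (i == j.+1 :> nat)%:R.

Definition krylov y : 'M[R]_N.+1 := \matrix_(i, j) (y ^+ j) i ord0.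

Lemma companion_hessenberg c : hessenberg (companion c).
Proof.
move=> i j ij; rewrite mxE; case: eqP => // j_max.
by move: ij (ltn_ord i); rewrite j_max /=; lia.
Qed.

Lemma unitriangular_unit u : unitriangular u -> u \in unitmx.
Proof.
move=> uT; rewrite unitmxE -det_tr det_trig; last first.
  by apply/is_trig_mxP => i j ij; rewrite mxE uT ?(ltnW ij) // -val_eqE gtn_eqF.
by rewrite big1 ?unitr1 // => i _; rewrite mxE uT ?eqxx.
Qed.

Lemma hessenberg_mull u y : unitriangular u -> hessenberg y -> hessenberg (u *m y).
Proof.
move=> uT yH i j ji; rewrite mxE (bigD1 i) //= uT // eqxx mul1r yH // big1 ?addr0 // => k ki.
have [le_ki|lt_ik] := leqP k i; first by rewrite uT // eq_sym (negPf ki) mul0r.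
by rewrite yH ?(ltn_trans ji) // gtn_eqF ?mulr0 // (leq_trans _ lt_ik).
Qed.

Lemma hessenberg_mulr u y : unitriangular u -> hessenberg y -> hessenberg (y *m u).
Proof.
move=> uT yH i j ji; rewrite mxE (bigD1 j) //= uT // eqxx mulr1 yH // big1 ?addr0 // => k kj.
have [le_jk|lt_kj] := leqP j k; first by rewrite uT // (negPf kj) mulr0.
by rewrite yH ?(ltn_trans lt_kj) // gtn_eqF ?mul0r // (leq_ltn_trans lt_kj).
Qed.

Lemma companion_inj : injective companion.
Proof.
move=> c c' /matrixP cc'; apply/matrixP => i j; move: (cc' i ord_max).
by rewrite !mxE eqxx ord1.
Qed.

(** Each factor [y] moves the last nonzero row of a vector down by one and keeps its value there,
    starting from the first basis vector. *)
Lemma krylov_unitriangular y : hessenberg y -> unitriangular (krylov y).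
Proof.
move=> yH i j; rewrite mxE -val_eqE /=; move: (j : nat) => {}j.
elim: j i => [|j IH] i ji; first by rewrite expr0 !mxE -val_eqE.
rewrite exprS mxE.
have iN : (i.-1 < N.+1)%N by have := ltn_ord i; lia.
rewrite (bigD1 (Ordinal iN)) //= yH /= ?IH /=; try lia.
rewrite big1 ?addr0 => [|k /eqP kk0].
  by rewrite prednK ?eqxx ?mul1r; [congr (_%:R); lia | lia].
have [ki|ik] := ltnP k i.
  rewrite yH // (_ : (_ == _) = false) ?mul0r //; apply/eqP => iE.
  by apply: kk0; apply: val_inj; rewrite /= iE.
by rewrite IH ?gtn_eqF ?mulr0 //; lia.
Qed.

Lemma krylov_unit y : hessenberg y -> krylov y \in unitmx.
Proof. by move=> /krylov_unitriangular/unitriangular_unit. Qed.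

Lemma comm_mxX y y' M k : y' *m M = M *m y -> y' ^+ k *m M = M *m y ^+ k.
Proof.
move=> yM; elim: k => [|k IH]; first by rewrite !expr0 mul1mx mulmx1.
by rewrite !exprS -mulmxE -mulmxA IH !mulmxA yM.
Qed.

Lemma krylovM_col M y : forall i j, (M *m krylov y) i j = (M *m y ^+ j) i ord0.
Proof. by move=> i j; rewrite !mxE; apply: eq_bigr => k _; rewrite mxE. Qed.

(** The first basis vector is cyclic for [y], so a matrix commuting with [y] is determined by its
    first column. *)
Lemma comm_hessenberg0 y M : hessenberg y -> y *m M = M *m y ->
  (forall i, M i ord0 = 0) -> M = 0.
Proof.
move=> yH yM M0; apply: (mulIr (krylov_unit yH)); rewrite mul0r.
apply/matrixP => i j; rewrite [RHS]mxE -mulmxE krylovM_col.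
by rewrite -(comm_mxX _ yM) mxE big1 // => k _; rewrite M0 mulr0.
Qed.

(** In the basis formed by the columns of [krylov y], the matrix [y] shifts each basis vector to the
    next one; only the last column is free. *)
Lemma hessenberg_companion y : hessenberg y ->
  exists c, y *m krylov y = krylov y *m companion c.
Proof.
move=> yH; set P := krylov y; have PU : P \in unitmx := krylov_unit yH.
exists (col ord_max (invmx P *m y *m P)); apply/matrixP => i j.
have [->|jmax] := eqVneq j ord_max.
  have -> : (y *m P) i ord_max = (P *m (invmx P *m y *m P)) i ord_max.
    by rewrite !mulmxA mulmxV // mul1mx.
  by rewrite !mxE; apply: eq_bigr => k _; rewrite !mxE eqxx.
have jN : (j.+1 < N.+1)%N by rewrite ltnS ltn_neqAle -ltnS ltn_ord andbT.
rewrite krylovM_col mulmxE -exprS mxE (bigD1 (Ordinal jN)) //= !mxE (negPf jmax) /= eqxx mulr1.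
rewrite big1 ?addr0 // => k kj; rewrite !mxE (negPf jmax).
by move: kj; rewrite -val_eqE /= => /negPf->; rewrite mulr0.
Qed.

Lemma companionX_col0 c (j : 'I_N.+1) i : (companion c ^+ j) i ord0 = (i == j)%:R.
Proof.
rewrite -val_eqE /=; case: j => j /= jN; elim: j jN i => [|j IH] jN i.
  by rewrite expr0 mxE.
have jN' : (j < N.+1)%N by lia.
rewrite exprS mxE (bigD1 (Ordinal jN')) //= IH //= eqxx mulr1 big1 ?addr0 => [|k kj].
  by rewrite mxE -val_eqE /= ltn_eqF.
by rewrite IH // (_ : (_ == _) = false) ?mulr0 //; apply: negbTE.
Qed.

Lemma krylov_companion c : krylov (companion c) = 1.
Proof. by apply/matrixP => i j; rewrite mxE companionX_col0 mxE. Qed.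

(** As [u] fixes the first basis vector e, its column [j] is [u *m companion c ^+ j] applied to e,
    hence [y ^+ j] applied to e. *)
Lemma krylov_unique y u c : unitriangular u -> y *m u = u *m companion c -> u = krylov y.
Proof.
move=> uT yu; apply/matrixP => i j.
have -> : u i j = (u *m companion c ^+ j) i ord0.
  by rewrite -krylovM_col krylov_companion mulmx1.
rewrite -(comm_mxX _ yu) !mxE (bigD1 ord0) //= uT // eqxx mulr1 big1 ?addr0 // => k k0.
by rewrite uT // (negPf k0) mulr0.
Qed.

(** The characteristic polynomial of [companion c], evaluated at [y]. *)
Definition companion_char c y : 'M[R]_N.+1 := y ^+ N.+1 - \sum_(k < N.+1) c k 0 *: y ^+ k.

Lemma companion_char_col0 c c' i : companion_char c (companion c') i ord0 = c' i 0 - c i 0.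
Proof.
rewrite !mxE summxE; congr (_ - _).
  rewrite exprS mxE (bigD1 ord_max) //= (companionX_col0 _ ord_max) eqxx mulr1 mxE eqxx.
  rewrite big1 ?addr0 // => k km; rewrite (companionX_col0 _ ord_max) (negPf km) mulr0 //.
rewrite (bigD1 i) //= mxE companionX_col0 eqxx mulr1 big1 ?addr0 // => k ki.
by rewrite mxE companionX_col0 eq_sym (negPf ki) mulr0.
Qed.

(** Cayley-Hamilton, as a case of [comm_hessenberg0]. *)
Lemma companion_char0 c : companion_char c (companion c) = 0.
Proof.
apply: (comm_hessenberg0 (companion_hessenberg c)) => [|i].
  rewrite mulmxBr mulmxBl mulmx_sumr mulmx_suml !mulmxE -exprS -exprSr; congr (_ - _).
  by apply: eq_bigr => k _; rewrite -scalerAl -scalerAr -exprS -exprSr.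
by rewrite companion_char_col0 subrr.
Qed.

(** For [s] a power of [w] the equalities are congruences. Transported by [g], the characteristic
    polynomial of [companion c] kills [companion c'] up to the factor [s]; its first column is then
    [s] times [c' - c]. *)
Lemma companion_conj c c' g s : g \in unitmx ->
  s *: (companion c' *m g) = s *: (g *m companion c) -> s *: c = s *: c'.
Proof.
move=> gU cg; have cgk k : s *: (companion c' ^+ k *m g) = s *: (g *m companion c ^+ k).
  elim: k => [|k IH]; first by rewrite !expr0 mul1mx mulmx1.
  rewrite !exprS -!mulmxE -mulmxA scalemxAr IH -scalemxAr !mulmxA !(scalemxAl _ _ (_ ^+ k)).
  by rewrite -cg.
have : s *: companion_char c (companion c') = 0.
  apply: (mulIr gU); rewrite mul0r -mulmxE -scalemxAl mulmxBl mulmx_suml scalerBr cgk.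
  transitivity (s *: (g *m companion_char c (companion c))); last first.
    by rewrite companion_char0 mulmx0 scaler0.
  rewrite mulmxBr mulmx_sumr scalerBr; congr (_ - _); rewrite !scaler_sumr.
  apply: eq_bigr => k _; rewrite -scalemxAl -scalemxAr !scalerA ![s * _]mulrC -!scalerA.
  by rewrite cgk.
move=> /matrixP h; apply/matrixP => i j; move: (h i ord0).
rewrite [LHS]mxE companion_char_col0 ord1 mxE mulrBr => /subr0_eq sc.
by rewrite !mxE sc.
Qed.

(* The Hankel matrix of the coefficients of the characteristic polynomial,
   which symmetrises the companion matrix. *)
Definition hankel_coef c k : R :=
  if insub k is Some i then - c i 0 else (k == N.+1)%:R.

Definition hankel c : 'M[R]_N.+1 := \matrix_(i, j) hankel_coef c (i + j).+1.

Lemma hankel_coef_ord c (i : 'I_N.+1) : hankel_coef c i = - c i 0.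
Proof. by rewrite /hankel_coef valK. Qed.

Lemma hankel_coef_out c k : (N < k)%N -> hankel_coef c k = (k == N.+1)%:R.
Proof. by move=> Nk; rewrite /hankel_coef insubF // ltnS leqNgt Nk. Qed.

Lemma hankel_sym c : (hankel c)^T = hankel c.
Proof. by apply/matrixP => i j; rewrite !mxE addnC. Qed.

(** Reversing the columns, by means of [W], makes the Hankel matrix unitriangular. *)
Lemma hankel_unit c : hankel c \in unitmx.
Proof.
pose W : 'M[R]_N.+1 := \matrix_(i, j) (i == rev_ord j)%:R.
have sW i j : (hankel c *m W) i j = hankel_coef c (i + (N - j)).+1.
  rewrite mxE (bigD1 (rev_ord j)) //= !mxE eqxx mulr1 big1 ?addr0 ?subSS // => k kj.
  by rewrite !mxE (negPf kj) mulr0.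
have /unitriangular_unit/mulmxV : unitriangular (hankel c *m W).
  move=> i j ji; rewrite sW hankel_coef_out; last by have := ltn_ord j; lia.
  by congr (_%:R); rewrite -val_eqE /=; have := ltn_ord j; lia.
by rewrite -mulmxA => /mulmx1_unit[].
Qed.

(** Below the first row the product has entries [hankel_coef c (i + j)], except that the last column
    of [companion c] cancels those of the first column; the first row vanishes off the corner. *)
Lemma companion_hankel_sym c : (companion c *m hankel c)^T = companion c *m hankel c.
Proof.
have E i j : (companion c *m hankel c) i j =
    c i 0 * (j == ord0)%:R + (if i == ord0 then 0 else hankel_coef c (i + j)).
  rewrite mxE (bigD1 ord_max) //= !mxE eqxx hankel_coef_out; last by rewrite /=; lia.
  congr (_ * _%:R + _); first by rewrite -val_eqE /=; lia.
  have [->|i0] := eqVneq i ord0.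
    by rewrite big1 // => k km; rewrite !mxE (negPf km) mul0r.
  have iN : (i.-1 < N.+1)%N by have := ltn_ord i; lia.
  have {}i0 : (0 < i)%N by rewrite lt0n.
  rewrite (bigD1 (Ordinal iN)) /=; last by rewrite -val_eqE /=; have := ltn_ord i; lia.
  rewrite !mxE -val_eqE /= prednK // eqxx ltn_eqF ?mul1r; last by have := ltn_ord i; lia.
  rewrite -addSn prednK // big1 ?addr0 // => k /andP[km ki]; rewrite !mxE (negPf km).
  rewrite (_ : (_ == _) = false) ?mul0r //; apply: contraNF ki => /eqP iE.
  by rewrite -val_eqE /= iE.
apply/matrixP => i j; rewrite mxE !E.
have [->|i0] := eqVneq i ord0; have [->|j0] := eqVneq j ord0; rewrite ?mulr1 ?mulr0 ?addr0 ?add0r //.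
- by rewrite addn0 hankel_coef_ord subrr.
- by rewrite addn0 hankel_coef_ord subrr.
- by rewrite addnC.
Qed.
End Hessenberg.

(** * Congruence subgroups *)

Section GLElements.
Variables (n : nat) (R : finComUnitRingType).
Local Notation GLn := {'GL_n[R]}.
Local Notation Mn := 'M[R]_n.-1.+1.
Implicit Types (g h : GLn) (M s : Mn).

(** A matrix that is not invertible is sent to the default value 1. *)
Definition glmx M : GLn := insubd (1%g : GLn) M.

Lemma glmxK M : M \is a GRing.unit -> GLval (glmx M) = M.
Proof. exact: insubdK. Qed.

Lemma GLval_unit g : GLval g \is a GRing.unit.
Proof. exact: (valP g). Qed.

Lemma GLval_inj g h : GLval g = GLval h -> g = h.
Proof. exact: val_inj. Qed.

Lemma GLval1 : GLval (1%g : GLn) = 1. Proof. by []. Qed.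
Lemma GLvalM g h : GLval (g * h)%g = GLval g *m GLval h. Proof. by []. Qed.
Lemma GLvalV g : GLval (g^-1)%g = invmx (GLval g). Proof. exact: GL_VE. Qed.

Lemma GLvalVK g : invmx (GLval g) *m GLval g = 1%:M.
Proof. by rewrite -GLvalV -GLvalM mulVg. Qed.
Lemma GLvalKV g : GLval g *m invmx (GLval g) = 1%:M.
Proof. by rewrite -GLvalV -GLvalM mulgV. Qed.

Lemma UP g : reflect (unitriangular (GLval g)) (g \in U_group n R).
Proof.
rewrite inE; apply: (iffP forallP) => [h i j ji|h i].
  have /forallP/(_ j)/andP[/implyP h1 /implyP h2] := h i.
  case: (eqVneq i j) h2 => [_ /(_ isT)/eqP //|ij _]; apply/eqP/h1.
  by rewrite ltn_neqAle ji andbT eq_sym.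
apply/forallP => j; apply/andP; split; [apply/implyP => ji | apply/implyP => /eqP<-]; last first.
  by rewrite h ?eqxx.
by rewrite h ?(ltnW ji) // -val_eqE gtn_eqF.
Qed.

Section Tau.
Variable s : Mn.
Hypotheses (sU : s \in unitmx) (s_sym : s^T = s).

(** The adjoint of [M] for the symmetric bilinear form with Gram matrix [invmx s]. *)
Definition mx_tau M : Mn := s *m M^T *m invmx s.
Definition gl_tau g : GLn := glmx (mx_tau (GLval g)).

Lemma mx_tauM M M' : mx_tau (M *m M') = mx_tau M' *m mx_tau M.
Proof. by rewrite /mx_tau trmx_mul !mulmxA mulmxKV. Qed.

Lemma mx_tauK : involutive mx_tau.
Proof.
move=> M; rewrite /mx_tau !trmx_mul trmxK trmx_inv s_sym !mulmxA mulmxV // mul1mx.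
by rewrite mulmxK.
Qed.

Lemma mx_tauB M M' : mx_tau (M - M') = mx_tau M - mx_tau M'.
Proof. by rewrite /mx_tau linearB /= mulmxBr mulmxBl. Qed.

Lemma mx_tau1 : mx_tau 1 = 1.
Proof. by rewrite /mx_tau trmx1 mulmx1 mulmxV. Qed.

Lemma mxtrace_tau M : \tr (mx_tau M) = \tr M.
Proof. by rewrite /mx_tau mxtrace_mulC mulmxA mulVmx // mul1mx mxtrace_tr. Qed.

Lemma det_tau M : \det (mx_tau M) = \det M.
Proof. by rewrite /mx_tau !det_mulmx det_tr mulrAC -det_mulmx mulmxV // det1 mul1r. Qed.

Lemma gl_tauE g : GLval (gl_tau g) = mx_tau (GLval g).
Proof. by rewrite glmxK // -[_ \is a _]/(_ \in unitmx) unitmxE det_tau -unitmxE GLval_unit. Qed.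

Lemma gl_tauM g h : gl_tau (g * h)%g = (gl_tau h * gl_tau g)%g.
Proof. by apply: GLval_inj; rewrite GLvalM !gl_tauE GLvalM mx_tauM. Qed.

Lemma gl_tauK : involutive gl_tau.
Proof. by move=> g; apply: GLval_inj; rewrite !gl_tauE mx_tauK. Qed.

Lemma mx_inI_tau w i M : mx_inI w i M -> mx_inI w i (mx_tau M).
Proof. by move=> Mi; rewrite /mx_tau mx_inIMr // mx_inIMl // mx_inI_tr. Qed.
End Tau.
End GLElements.

Section Congruence.
Variables (n : nat) (R : finComUnitRingType) (w : R) (l : nat) (phi : R -> algC).
Hypotheses (cR : chain_ring w l) (phi_add : additive_char phi) (phi_prim : primitive_char w phi l).
Local Notation GLn := {'GL_n[R]}.
Local Notation Mn := 'M[R]_n.-1.+1.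
Local Notation K i := (Ker_group n w i).
Implicit Types (g h : GLn) (M y : Mn).

Lemma KerE i g : (g \in K i) = mx_inI w i (GLval g - 1).
Proof. by rewrite inE. Qed.

Lemma Ker_sub i j : (i <= j)%N -> K j \subset K i.
Proof. by move=> ij; apply/subsetP => g; rewrite !KerE; apply: mx_inI_leq. Qed.

Lemma GLvalJ g h : GLval (g ^ h)%g - 1 = invmx (GLval h) *m (GLval g - 1) *m GLval h.
Proof. by rewrite conjgE !GLvalM GLvalV mulmxBr mulmx1 mulmxBl GLvalVK mulmxA. Qed.

Lemma KerJ i g h : ((g ^ h)%g \in K i) = (g \in K i).
Proof.
suff KJ g' h' : g' \in K i -> (g' ^ h')%g \in K i.
  by apply/idP/idP => /KJ // /(_ h^-1%g); rewrite conjgK.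
by rewrite !KerE GLvalJ => ?; rewrite mx_inIMr // mx_inIMl.
Qed.

Lemma Ker_normal (G : {group GLn}) i : K i \subset G -> (K i <| G)%g.
Proof.
move=> KG; rewrite /normal KG; apply/subsetP => h _; rewrite inE.
by apply/subsetP => _ /imsetP[g Kg ->]; rewrite KerJ.
Qed.

Lemma glmx_Ker i M : (0 < i)%N -> mx_inI w i (M - 1) ->
  GLval (glmx M) = M /\ glmx M \in K i.
Proof.
move=> i0 Mi; have ME : GLval (glmx M) = M.
  by apply: glmxK; apply: (mx_inI1_unit cR); apply: mx_inI_leq Mi.
by rewrite KerE ME.
Qed.

Lemma phixM_mod y g h : (GLval g - 1) *m (GLval h - 1) = 0 ->
  phix_fun phi y (g * h)%g = phix_fun phi y g * phix_fun phi y h.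
Proof.
move=> gh0; rewrite /phix_fun -(phiD phi_add) -mxtraceD -mulmxDr; congr (phi (\tr (_ *m _))).
move/eqP: gh0; rewrite GLvalM mulmxBr mulmxBl mul1mx mulmx1 subr_eq0 => /eqP/esym e.
by rewrite e addrA subrK.
Qed.

Lemma phixM y i : (l <= i + i)%N ->
  {in K i &, forall g h, phix_fun phi y (g * h)%g = phix_fun phi y g * phix_fun phi y h}.
Proof. by move=> li g h Kg Kh; apply: phixM_mod; apply: (mx_inIM_eq0 cR li); rewrite -KerE. Qed.

Lemma phix1 y : phix_fun phi y (1%g : GLn) = 1.
Proof. by rewrite /phix_fun subrr mulmx0 mxtrace0 phi0. Qed.

Lemma phixJ y g h :
  phix_fun phi y (g ^ h)%g = phix_fun phi (GLval h *m y *m invmx (GLval h)) g.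
Proof. by rewrite /phix_fun GLvalJ !mulmxA mxtrace_mulC !mulmxA. Qed.

Lemma phix_congr i y y' g : g \in K i -> (i <= l)%N -> mx_inI w (l - i) (y - y') ->
  phix_fun phi y g = phix_fun phi y' g.
Proof.
rewrite KerE => Kg il yy'; apply/eqP; rewrite -subr_eq0 /phix_fun.
rewrite -[y in X in X - _](subrK y') mulmxDl (mx_inIM_eq0 cR _ yy' Kg) ?add0r ?subrr //.
by rewrite subnK.
Qed.

(** If [w ^+ i *: (y - y')] were nonzero, nondegeneracy of the trace form would give an element 1 +
    w^i t of [K i] separating the two characters. *)
Lemma phix_inj i y y' : (0 < i <= l)%N ->
  {in K i, phix_fun phi y =1 phix_fun phi y'} -> mx_inI w (l - i) (y - y').
Proof.
case/andP=> i0 il yy'; rewrite (mx_inI_annE cR) ?leq_subr // subKn //.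
apply: contraT => /(phi_tr_nondeg cR phi_prim)[t /eqP[]].
have ti : mx_inI w i (1 + w ^+ i *: t - 1).
  by rewrite addrAC subrr add0r; apply/mx_inIP; exists t.
have [gE gK] := glmx_Ker i0 ti; have := yy' _ gK.
rewrite /phix_fun gE addrAC subrr add0r -!scalemxAr scalemxAl => e.
rewrite scalerBr mulmxBl raddfB /= (phiD phi_add) e phiN // -!scalemxAl.
by rewrite mulfV ?phi_neq0.
Qed.
End Congruence.

(** * The Gelfand-Graev character *)

Section GelfandGraev.
Variables (n : nat) (R : finComUnitRingType) (w : R) (l : nat) (phi : R -> algC).
Hypotheses (cR : chain_ring w l) (phi_add : additive_char phi) (phi_prim : primitive_char w phi l).
Local Notation GLn := {'GL_n[R]}.
Local Notation Mn := 'M[R]_n.-1.+1.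
Local Notation cVn := 'cV[R]_n.-1.+1.
Local Notation K i := (Ker_group n w i).
Local Notation U := (U_group n R).
Local Notation m := l./2.
Local Notation m' := (l - l./2)%N.
Local Notation A := (Ker_group n w (l - l./2)).
Variable G : {group GLn}.
Hypotheses (K1G : K 1 \subset G) (UG : U \subset G).
Implicit Types (g h u v : GLn) (M y : Mn) (c : cVn) (i : Iirr G).

Let l_gt1 : (1 < l)%N := chain_gt1 cR.
Let m_gt0 : (0 < m)%N. Proof. by rewrite half_gt0. Qed.
Let l2m' : (l <= m' + m')%N. Proof. by have := odd_double_half l; lia. Qed.
Let m'_le_pred : (m' <= l.-1)%N. Proof. by have := odd_double_half l; lia. Qed.
Let m_le_m' : (m <= m')%N. Proof. by have := odd_double_half l; lia. Qed.
Let m_le_l : (m <= l)%N. Proof. by lia. Qed.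
Let m'_gt0 : (0 < m')%N. Proof. exact: leq_trans m_gt0 m_le_m'. Qed.
Let l_le_m'm : (l <= m' + m)%N. Proof. by rewrite subnK. Qed.
Let l_predK : (l - l.-1 = 1)%N. Proof. by lia. Qed.
Let m'_bounds : (0 < m' <= l)%N. Proof. by rewrite m'_gt0 leq_subr. Qed.
Let lm' : (l - m' = m)%N. Proof. by have := odd_double_half l; lia. Qed.

Lemma A_sub_G : A \subset G.
Proof. by apply: subset_trans (Ker_sub _ _ _) K1G. Qed.

Lemma A_normal : (A <| G)%g. Proof. exact: Ker_normal A_sub_G. Qed.

(** Conjugation by [k] changes [y] by a multiple of its commutator with [k - 1], which vanishes
    modulo w^m, and a character of [A] depends on [y] only modulo w^m. *)
Lemma phix_stab y k v : k \in K m -> v \in A ->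
  phix_fun phi y (v ^ k)%g = phix_fun phi y v.
Proof.
move=> Kk Av; rewrite phixJ; apply: (phix_congr phi cR Av); rewrite ?leq_subr // lm'.
have -> : GLval k *m y *m invmx (GLval k) - y =
    ((GLval k - 1) *m y - y *m (GLval k - 1)) *m invmx (GLval k).
  rewrite [(_ - 1) *m y]mulmxBl [y *m (_ - 1)]mulmxBr mul1mx mulmx1 opprB addrA subrK mulmxBl.
  by rewrite -[y *m _ *m _]mulmxA GLvalKV mulmx1.
by rewrite KerE in Kk; apply: mx_inIMr; apply: mx_inIB; [apply: mx_inIMr | apply: mx_inIMl].
Qed.

(* Conjugating by [k = 1 + w^j t], with [j] maximal such that [w^j (u - 1)]
   is nonzero, multiplies the sum by [phix_fun phi y c != 1]. *)
Lemma sum_char_coset0 (chi : 'CF(G)) u y : u \in U -> u \notin A -> hessenberg y ->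
  \sum_(v in A) chi (u * v)%g * (phix_fun phi y v)^* = 0.
Proof.
move=> /UP uT uA yH; pose X := GLval u - 1.
have X0 : w ^+ m *: X != 0 by rewrite -lm' -(mx_inI_annE cR) ?leq_subr // -KerE.
have Xj j : w ^+ j *: X != 0 -> (j <= l)%N.
  by apply: contraR; rewrite -ltnNge => /ltnW/(chain_wgeq0 cR) ->; rewrite scale0r.
have [j wjX maxj] := ex_maxnP (ex_intro (fun j => w ^+ j *: X != 0) _ X0) Xj.
have mj : (m <= j)%N := maxj _ X0; have j_gt0 : (0 < j)%N := leq_trans m_gt0 mj.
pose M := w ^+ j *: X; have wM : w *: M = 0.
  rewrite /M scalerA -exprS; apply/eqP; apply: contraT => /maxj.
  by rewrite ltnn.
have uM : GLval u *m M = M *m GLval u.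
  by rewrite /M -scalemxAl -scalemxAr /X mulmxBl mulmxBr mul1mx mulmx1.
have uVM : invmx (GLval u) *m M = M *m invmx (GLval u).
  by rewrite -[LHS]mulmx1 -(GLvalKV u) !mulmxA -(mulmxA _ M) -uM mulmxA GLvalVK mul1mx.
(* [M] is nonzero with zero first column, so it cannot commute with the Hessenberg matrix [y]. *)
have D0 : (M *m y - y *m M) *m invmx (GLval u) != 0.
  apply: contra_neq wjX => D0; have {}D0 : y *m M = M *m y.
    apply/esym/eqP; rewrite -subr_eq0 -[_ - _]mulmx1 -(GLvalVK u) mulmxA.
    by move/(congr1 (fun Z => Z *m GLval u)): D0; rewrite mul0mx => ->.
  apply: (comm_hessenberg0 yH D0) => i.
  by rewrite !mxE uT // subrr mulr0.
have [t phi_t] := phi_tr_nondeg cR phi_prim D0.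
have kj : mx_inI w j (1 + w ^+ j *: t - 1).
  by rewrite addrAC subrr add0r; apply/mx_inIP; exists t.
have [kE Kk] := glmx_Ker cR j_gt0 kj; set k := glmx _ in kE Kk.
have Gk : k \in G by rewrite (subsetP K1G) // (subsetP (Ker_sub n w j_gt0)).
clearbody k.
pose E := t *m M - M *m t.
have Ek : E *m invmx (GLval k) = E.
  have wE : w *: E = 0.
    by rewrite scalerBr [w *: (M *m t)]scalemxAl wM mul0mx subr0 scalemxAr wM mulmx0.
  rewrite -[RHS]mulmx1 -(GLvalKV k) mulmxA; congr (_ *m _).
  by rewrite kE mulmxDr mulmx1 -scalemxAr -(prednK j_gt0) exprSr -scalerA scalemxAl wE mul0mx scaler0 addr0.
(* Because [w] kills [M], this commutator equals 1 + u^-1 (tM - Mt) exactly; it therefore lies in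
   K^(l-1), inside [A]. *)
pose c := (u^-1 * u ^ k^-1)%g.
have cE : GLval c - 1 = invmx (GLval u) *m E.
  rewrite -Ek mulmxA.
  have <- : GLval k *m GLval u - GLval u *m GLval k = E.
    rewrite kE mulmxDl mulmxDr mul1mx mulmx1 opprD addrACA subrr add0r.
    rewrite -scalemxAl -scalemxAr -scalerBr /E /M -scalemxAr -scalemxAl -scalerBr /X.
    by rewrite mulmxBr mulmxBl mulmx1 mul1mx opprB addrA subrK.
  rewrite mulmxBr mulmxBl !mulmxA GLvalVK mul1mx GLvalKV.
  by rewrite /c conjgE invgK !GLvalM !GLvalV !mulmxA.
have uc : (u * c = u ^ k^-1)%g by rewrite /c mulKVg.
clearbody c; have Ac : c \in A.
  apply: (subsetP (Ker_sub n w m'_le_pred)).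
  rewrite KerE (mx_inI_annE cR) ?leq_pred // cE l_predK.
  by rewrite expr1 scalemxAr scalerBr scalemxAr wM mulmx0 scalemxAl wM mul0mx subrr mulmx0.
have phi_c : phix_fun phi y c != 1.
  move: phi_t; rewrite /phix_fun cE mulmxBl; congr (phi _ != 1).
  rewrite !mulmxBr !mulmxBl !raddfB /=; congr (_ - _).
    by rewrite !mulmxA -[in RHS]mxtrace_mulC !mulmxA.
  by rewrite -(mulmxA y) -uVM !mulmxA.
set T := \sum_(v in A) _; apply/eqP.
have : (phix_fun phi y c)^* * T == T.
  (* Replacing [v] by [c * v ^ k^-1] turns [u * v] into its conjugate [(u * v) ^ k^-1], where [chi]
     has the same value. *)
  rewrite {2}/T (reindex_inj (inj_comp (mulgI c) (conjg_inj k^-1%g))) /=.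
  apply/eqP; rewrite mulr_sumr; apply: eq_big => v; first by rewrite groupMl ?KerJ.
  move=> Av; have kV : (k^-1 \in K m)%g by rewrite groupV (subsetP (Ker_sub n w mj)).
  rewrite [phix_fun _ _ (c * _)%g](phixM cR phi_add y l2m') ?KerJ // (phix_stab y kV Av) rmorphM mulrCA; congr (_ * _).
  have -> : (u * (c * v ^ k^-1) = (u * v) ^ k^-1)%g.
    by rewrite conjMg -uc mulgA.
  by rewrite (cfunJ _ _ (groupVr Gk)).
rewrite -subr_eq0 -{2}[T]mul1r -mulrBl mulf_eq0 => /orP[|//].
by rewrite subr_eq0 -(inj_eq (inv_inj (@conjCK _))) conjCK rmorph1 (negPf phi_c).
Qed.

(** * Hessenberg matrices and the character theta *)

Definition hess_set : {set Mn} :=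
  [set y : Mn | [forall i : 'I_n.-1.+1, forall j : 'I_n.-1.+1, (j < i)%N ==> (y i j == (i == j.+1 :> nat)%:R)]].

Lemma hess_setP y : reflect (hessenberg y) (y \in hess_set).
Proof.
rewrite inE; apply: (iffP forallP) => [h i j ji|h i].
  by have /forallP/(_ j)/implyP/(_ ji)/eqP := h i.
by apply/forallP => j; apply/implyP => /(h i j)->.
Qed.

(** The nilpotent Jordan block; on [U], [phix_fun phi J] is the character theta_1. *)
Local Notation J := (companion 0 : Mn).

Lemma phix_hess_U y u : hessenberg y -> u \in U -> phix_fun phi y u = phix_fun phi J u.
Proof.
move=> yH /UP uT; rewrite /phix_fun; congr phi; apply/eqP.
rewrite -subr_eq0 -raddfB -mulmxBl /=; apply/eqP.
rewrite /mxtrace big1 // => i _; rewrite mxE big1 // => j _; rewrite [(y - J) _ _]mxE [(GLval u - 1) _ _]mxE.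
have [ij|ji] := leqP i j.
  by rewrite (uT _ _ ij) !mxE subrr mulr0.
by rewrite yH // [(- J) _ _]mxE (companion_hessenberg 0 ji) subrr mul0r.
Qed.

(** Fourier inversion: a nonzero entry of [v - 1] on or below the diagonal is paired with a free
    entry of [y], and translating that entry multiplies the sum by a nontrivial value of [phi]. *)
Lemma sum_hess_phix v : \sum_(y in hess_set) phix_fun phi y v =
  (v \in U)%:R * #|hess_set|%:R * phix_fun phi J v.
Proof.
have [Uv|] := boolP (v \in U).
  rewrite mul1r mulr_natl -sumr_const.
  by apply: eq_bigr => y /hess_setP yH; apply: phix_hess_U.
move=> Uv; rewrite !mul0r; have [[i j] /= /andP[ji vij]] :
    exists ij : 'I_n.-1.+1 * 'I_n.-1.+1, (ij.2 <= ij.1)%N && (GLval v ij.1 ij.2 - (ij.1 == ij.2)%:R != 0).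
  apply/existsP; apply: contraNT Uv => /existsPn h; apply/UP => i j ji.
  by have := h (i, j); rewrite ji negbK subr_eq0 => /eqP.
have [r phi_r] := phi_nondeg cR phi_prim vij.
set T := \sum_(y in _) _; apply/eqP.
have : phi (r * (GLval v i j - (i == j)%:R)) * T == T.
  rewrite {2}/T (reindex_inj (addIr (r *: delta_mx j i))) /=; apply/eqP.
  rewrite mulr_sumr; apply: eq_big => y.
    rewrite !inE; apply: eq_forallb => p; apply: eq_forallb => q; rewrite !mxE.
    have [qp|//] := ltnP q p.
    rewrite (_ : (p == j) && (q == i) = false) ?mulr0 ?addr0 //.
    by apply/andP => -[/eqP pj /eqP qi]; move: qp; rewrite pj qi ltnNge ji.
  move=> yH; rewrite /phix_fun mulmxDl mxtraceD (phiD phi_add) mulrC; congr (_ * phi _).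
  rewrite mxtrace_mulC -scalemxAr mxtraceZ mxtrace_mul_delta.
  by rewrite !mxE.
by rewrite -subr_eq0 -{2}[T]mul1r -mulrBl mulf_eq0 subr_eq0 (negPf phi_r).
Qed.

(** The map [f] is a bijection from pairs (u, c) with u in [U] onto the Hessenberg matrices;
    [krylov] recovers u, and then [companion_inj] determines c. *)
Lemma sum_hess (F : Mn -> algC) :
  \sum_(y in hess_set) F y =
  \sum_(u in U) \sum_c F (GLval u *m companion c *m invmx (GLval u)).
Proof.
pose f (p : GLn * cVn) := GLval p.1 *m companion p.2 *m invmx (GLval p.1).
pose X := [set p : GLn * cVn | p.1 \in U].
have fE p : f p *m GLval p.1 = GLval p.1 *m companion p.2.
  by rewrite /f -!mulmxA GLvalVK mulmx1.
have f_inj : {in X &, injective f}.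
  move=> p q; rewrite [p \in X]inE [q \in X]inE => /UP pU /UP qU fpq.
  have := fE q; rewrite -fpq => /(krylov_unique qU) qK; have pK := krylov_unique pU (fE p).
  have pq : p.1 = q.1 by apply: GLval_inj; rewrite pK qK.
  apply: injective_projections => //; apply: companion_inj.
  move: fpq; rewrite /f pq => /(congr1 (fun M => M *m GLval q.1)); rewrite -!mulmxA GLvalVK !mulmx1.
  by move/(congr1 (mulmx (invmx (GLval q.1)))); rewrite !mulmxA GLvalVK !mul1mx.
have -> : hess_set = f @: X.
  apply/setP => y; apply/hess_setP/imsetP => [yH|[p]].
    have [c yc] := hessenberg_companion yH.
    have kE := glmxK (krylov_unit yH).
    exists (glmx (krylov y), c); first by rewrite inE; apply/UP; rewrite kE; apply: krylov_unitriangular.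
    by rewrite /f /= kE -yc -mulmxA mulmxV ?mulmx1 // krylov_unit.
  rewrite inE => pU ->; rewrite /f -GLvalV; apply: hessenberg_mulr.
    by apply/UP; rewrite groupV.
  by apply: hessenberg_mull; [apply/UP | apply: companion_hessenberg].
rewrite big_imset //= pair_big /=; apply: eq_bigl => p.
by rewrite inE andbT.
Qed.

Lemma card_hess_set : #|hess_set| = (#|U| * #|{: cVn}|)%N.
Proof.
apply/eqP; rewrite -(@eqr_nat algC) natrM -sumr_const sum_hess.
by under eq_bigr do rewrite sumr_const; rewrite sumr_const mulr_natl.
Qed.

Lemma hess_set_gt0 : (0 < #|hess_set|)%N.
Proof. by rewrite card_hess_set muln_gt0 cardG_gt0; apply/card_gt0P; exists 0. Qed.

(** The multiplicity denoted k(y) in the overview. *)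
Definition coefA (i : Iirr G) y := '['Res[A] 'chi_i, mkCF A (phix_fun phi y)].
Definition whittaker (i : Iirr G) := '['Res[U] 'chi_i, mkCF U (phix_fun phi J)].

Let psiE y v : mkCF A (phix_fun phi y) v = if v \in A then phix_fun phi y v else 0.
Proof. by apply: mkCFE; [apply: phix1 | apply: (phixM cR)]. Qed.

Let psi_lin y : mkCF A (phix_fun phi y) \is a linear_char.
Proof. by apply: mkCF_lin_char; [apply: phix1 | apply: (phixM cR)]. Qed.

(** The product of [u - 1] and [v - 1] vanishes on the first superdiagonal, the only place that [J]
    detects. *)
Lemma phixM_U : {in U &, forall u v, phix_fun phi J (u * v)%g = phix_fun phi J u * phix_fun phi J v}.
Proof.
move=> u v /UP uT /UP vT; rewrite /phix_fun -(phiD phi_add) -mxtraceD -mulmxDr.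
have -> : GLval (u * v)%g - 1 = (GLval u - 1) *m (GLval v - 1) + (GLval u - 1 + (GLval v - 1)).
  by rewrite GLvalM mulmxBr mulmxBl mul1mx mulmx1 addrA subrK addrA subrK.
rewrite [in LHS]mulmxDr mxtraceD [X in X + _](_ : _ = 0) ?add0r //.
rewrite /mxtrace big1 // => i _; rewrite mxE big1 // => j _.
have [ij|ji] := eqVneq (i : nat) j.+1; last first.
  by rewrite mxE (negPf ji); case: eqP => _; rewrite ?mxE mul0r.
rewrite [X in _ * X]mxE big1 ?mulr0 // => k _; have [kj|jk] := leqP k j.
  by rewrite !mxE uT // subrr mul0r.
by rewrite [(GLval v - 1) _ _]mxE vT ?ij // !mxE subrr mulr0.
Qed.

Lemma coefAE i y : coefA i y = #|A|%:R^-1 * \sum_(v in A) 'chi_i v * (phix_fun phi y v)^*.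
Proof.
rewrite /coefA cfdotE; congr (_ * _); apply: eq_bigr => v Av.
by rewrite cfResE ?A_sub_G // psiE Av.
Qed.

Lemma whittakerE i :
  whittaker i = #|U|%:R^-1 * \sum_(u in U) 'chi_i u * (phix_fun phi J u)^*.
Proof.
rewrite /whittaker cfdotE; congr (_ * _); apply: eq_bigr => u Uu.
by rewrite cfResE // mkCFE ?Uu //; [apply: phix1 | apply: phixM_U].
Qed.

Lemma coefA_nat i y : coefA i y \in Num.nat.
Proof. by apply: Cnat_cfdot_char; rewrite ?cfRes_char ?irr_char // lin_charW. Qed.

Lemma whittaker_nat i : whittaker i \in Num.nat.
Proof.
apply: Cnat_cfdot_char; rewrite ?cfRes_char ?irr_char // lin_charW //.
by apply: mkCF_lin_char; [apply: phix1 | apply: phixM_U].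
Qed.

Lemma coefAJ i y g : g \in G -> coefA i (GLval g *m y *m invmx (GLval g)) = coefA i y.
Proof.
move=> Gg; rewrite !coefAE; congr (_ * _).
rewrite [RHS](reindex_inj (conjg_inj g)) /=; apply: eq_big => v; first by rewrite KerJ.
by move=> Av; rewrite phixJ cfunJ.
Qed.

(** The sum over [U] collapses to [A], where an average over Hessenberg matrices stands for the
    indicator of [U]; [sum_hess] then groups these matrices into [U]-orbits of companion
    matrices. *)
Lemma whittaker_sum i :
  whittaker i = #|A|%:R / (#|U|%:R * #|{: cVn}|%:R) * \sum_c coefA i (companion c).
Proof.
pose S u := \sum_(v in A) 'chi_i (u * v)%g * ((v \in U)%:R * (phix_fun phi J v)^*).
have nH0 : #|hess_set|%:R != 0 :> algC by rewrite pnatr_eq0 -lt0n hess_set_gt0.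
have nU0 : #|U|%:R != 0 :> algC by rewrite neq0CG.
have nA0 : #|A|%:R != 0 :> algC by rewrite neq0CG.
have SE u : S u = #|hess_set|%:R^-1 *
    \sum_(y in hess_set) \sum_(v in A) 'chi_i (u * v)%g * (phix_fun phi y v)^*.
  rewrite exchange_big /= mulr_sumr; apply: eq_bigr => v Av.
  rewrite -mulr_sumr [RHS]mulrCA; congr (_ * _); rewrite -rmorph_sum sum_hess_phix.
  by rewrite !rmorphM !rmorph_nat [_ * #|_|%:R]mulrC -mulrA mulKf.
have S0 u : u \in U -> u \notin A -> S u = 0.
  move=> Uu Au; rewrite SE big1 ?mulr0 // => y /hess_setP yH.
  exact: sum_char_coset0.
(* Averaging over translates by the intersection of [U] and [A] produces the sums [S u]; by [S0]
   only those with [u] in [A] survive, and each of these contributes [S 1]. *)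
have W0 : \sum_(u in U) 'chi_i u * (phix_fun phi J u)^* = S 1%g.
  have UA_gt0 : #|(U :&: A)%G|%:R != 0 :> algC by rewrite neq0CG.
  apply: (mulfI UA_gt0); rewrite mulr_natl -sumr_const.
  transitivity (\sum_(u in U) (phix_fun phi J u)^* * S u).
    transitivity (\sum_(v in (U :&: A)%G) \sum_(u in U) 'chi_i (u * v)%g * (phix_fun phi J (u * v)%g)^*).
      apply: eq_bigr => v /setIP[Uv _]; rewrite (reindex_inj (mulIg v)) /=.
      by apply: eq_bigl => u; rewrite groupMr.
    rewrite exchange_big /=; apply: eq_bigr => u Uu; rewrite /S mulr_sumr.
    rewrite [RHS](bigID (fun v => v \in U)) /= [X in _ + X]big1 ?addr0; last first.
      by move=> v /andP[_ /negPf->]; rewrite mul0r !mulr0.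
    apply: eq_big => v; first by rewrite /= in_setI andbC.
    case/setIP=> Uv _; rewrite Uv mul1r phixM_U // rmorphM; ring.
  rewrite (bigID (fun u => u \in A)) /= [X in _ + X]big1 ?addr0; last first.
    by move=> u /andP[Uu Au]; rewrite S0 // mulr0.
  rewrite mulr_natl -sumr_const; apply: eq_big => u; first by rewrite /= in_setI.
  case/andP=> Uu Au; rewrite /S mulr_sumr [RHS](reindex_inj (mulgI u)) /=.
  apply: eq_big => v; first by rewrite groupMl.
  move=> Av; rewrite mul1g groupMl //; have [Uv|Uv] := boolP (v \in U); last first.
    by rewrite !mul0r !mulr0.
  by rewrite phixM_U // rmorphM; ring.
have -> : \sum_c coefA i (companion c) = #|U|%:R^-1 * \sum_(y in hess_set) coefA i y.
  rewrite sum_hess [in RHS](eq_bigr (fun=> \sum_c coefA i (companion c))) => [|u Uu].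
    by rewrite sumr_const -[X in _ * X]mulr_natl mulKf.
  by apply: eq_bigr => c _; rewrite coefAJ // (subsetP UG).
rewrite whittakerE W0 SE card_hess_set natrM.
rewrite (eq_bigr (fun y => #|A|%:R * coefA i y)) => [|y _]; last first.
  by rewrite coefAE mulVKf //; apply: eq_bigr => v _; rewrite mul1g.
move: nH0; rewrite card_hess_set natrM mulf_eq0 negb_or => /andP[_ nc0].
by rewrite -mulr_sumr; field; rewrite nU0 nc0.
Qed.

(** Two evaluations of the inner product of the characters induced from [A]: through irreducible
    constituents, and by Mackey's formula. *)
Lemma sum_coefA_mul y y' :
  \sum_i coefA i y * coefA i y' = #|A|%:R^-1 *
    \sum_(g in G) (mx_inI w m (GLval g *m y *m invmx (GLval g) - y'))%:R.
Proof.
transitivity '['Ind[G] (mkCF A (phix_fun phi y)), 'Ind[G] (mkCF A (phix_fun phi y'))].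
  rewrite cfdot_sum_irr; apply: eq_bigr => i _.
  by rewrite -!cfdot_Res_r !(cfdotC _ ('Res _)) conjCK [in RHS]conj_natr ?coefA_nat.
rewrite (cfdot_Ind_normal _ _ A_normal); congr (_ * _); apply: eq_bigr => g Gg.
rewrite cfdot_lin_char ?cfConjg_lin_char //; congr ((nat_of_bool _)%:R).
have NA : (g^-1 \in 'N(A))%g by rewrite groupV (subsetP (normal_norm A_normal)).
have conjE v : v \in A -> (mkCF A (phix_fun phi y) ^ g^-1)%CF v =
    phix_fun phi (GLval g *m y *m invmx (GLval g)) v.
  by move=> Av; rewrite cfConjgE // invgK psiE KerJ Av phixJ.
apply/idP/idP => [/eqP e|e].
  rewrite -lm'; apply: (phix_inj cR phi_add phi_prim m'_bounds).
  by move=> v Av; rewrite -conjE // e psiE Av.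
apply/eqP/cfun_inP => v Av; rewrite conjE // psiE Av.
by apply: (phix_congr phi cR Av); rewrite ?leq_subr // lm'.
Qed.

(** Clifford theory for [A]: the sum of nonnegative terms in [sum_coefA_mul] is nonzero, so some [g]
    contributes to its right side. *)
Lemma coefA_conj i y y' : coefA i y != 0 -> coefA i y' != 0 ->
  exists2 g, g \in G & mx_inI w m (GLval g *m y *m invmx (GLval g) - y').
Proof.
move=> yi y'i; have : \sum_i coefA i y * coefA i y' != 0.
  rewrite psumr_eq0 => [|j _]; last by rewrite mulr_ge0 // natr_ge0 ?coefA_nat.
  apply/negP => /allP/(_ i (mem_index_enum i)) /=.
  by rewrite mulf_eq0 (negPf yi) (negPf y'i).
rewrite sum_coefA_mul mulf_eq0 negb_or => /andP[_ sum_neq0].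
have [g /andP[Gg yg]] : exists g,
    (g \in G) && mx_inI w m (GLval g *m y *m invmx (GLval g) - y').
  apply/existsP; apply: contraNT sum_neq0 => /existsPn h; rewrite big1 // => g Gg.
  by have := h g; rewrite Gg andTb => /negPf->.
by exists g.
Qed.

Lemma coefA_companion_inj i c c' :
  coefA i (companion c) != 0 -> coefA i (companion c') != 0 -> w ^+ m' *: c = w ^+ m' *: c'.
Proof.
move=> ci c'i; have [g Gg] := coefA_conj ci c'i.
rewrite (mx_inI_annE cR _ m_le_l) => /eqP e; apply: (companion_conj (GLval_unit g)); apply/esym/eqP.
rewrite -subr_eq0 -scalerBr.
rewrite -[GLval g *m companion c]mulmx1 -(GLvalVK g) mulmxA -mulmxBl.
by rewrite scalemxAl e mul0mx.
Qed.

(** The d of the overview is the order of this set for [k = m] divided by its order for [k = m']. *)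
Definition strict_upper_set (k : nat) : {set Mn} :=
  [set M : Mn | [forall p : 'I_n.-1.+1, forall q : 'I_n.-1.+1,
     M p q \in (if (p < q)%N then ideal w k else [set 0])]].

Local Notation upairs := (\sum_(p < n.-1.+1) \sum_(q < n.-1.+1) (p < q)%N)%N.

Lemma card_strict_upper (k : nat) : #|strict_upper_set k| = (#|ideal w k| ^ upairs)%N.
Proof.
rewrite card_mx_family expn_sum; apply: eq_bigr => p _; rewrite expn_sum.
by apply: eq_bigr => q _; case: ltnP => _; rewrite ?cards1.
Qed.

Lemma upairsE : (n.-1.+1 ^ 2 = upairs.*2 + n.-1.+1)%N.
Proof.
transitivity (\sum_(p < n.-1.+1) \sum_(q < n.-1.+1) ((p < q) + (q < p) + (p == q)))%N.
  rewrite (eq_bigr (fun=> n.-1.+1)) ?sum_nat_const ?card_ord ?mulnn // => p _.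
  rewrite (eq_bigr (fun=> 1%N)) ?sum1_card ?card_ord // => q _.
  by rewrite -val_eqE /=; case: ltngtP.
under eq_bigr do rewrite !big_split; rewrite !big_split /= -addnn; congr (_ + _ + _)%N.
  by rewrite exchange_big.
rewrite (eq_bigr (fun=> 1%N)) ?sum1_card ?card_ord // => p _.
rewrite (bigD1 p) //= eqxx big1 // => q qp.
by rewrite eq_sym (negPf qp).
Qed.

Lemma card_U : #|U| = (#|{: R}| ^ upairs)%N.
Proof.
transitivity #|strict_upper_set 0|; last by rewrite card_strict_upper card_ideal0.
rewrite -(card_imset _ (inj_comp (addIr (-1 : Mn)) (@GLval_inj n R))); apply: eq_card => M.
rewrite inE; apply/imsetP/forallP => [[u /UP uT ->] p|h].
  apply/forallP => q; rewrite !mxE; have [pq|qp] := ltnP p q.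
    by rewrite inE; apply/existsP; exists ((GLval u p q) - (p == q)%:R); rewrite expr0 mul1r.
  by rewrite inE uT // [p == q]eq_sym subrr.
have M1T : unitriangular (M + 1).
  move=> p q qp; have /forallP/(_ q) := h p; rewrite ltnNge qp inE mxE => /eqP->.
  by rewrite add0r mxE.
have M1E : GLval (glmx (M + 1)) = M + 1 by apply: glmxK; apply: unitriangular_unit.
by exists (glmx (M + 1)); [apply/UP; rewrite M1E | rewrite /= M1E addrK].
Qed.

Lemma card_A : #|A| = (#|ideal w m'| ^ (n.-1.+1 ^ 2))%N.
Proof.
transitivity #|[set M : Mn | [forall p : 'I_n.-1.+1, forall q : 'I_n.-1.+1, M p q \in ideal w m']]|.
  rewrite -(card_imset _ (inj_comp (addIr (-1 : Mn)) (@GLval_inj n R))); apply: eq_card => M.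
  rewrite inE; apply/imsetP/forallP => [[v Av ->] p|h].
    apply/forallP => q; rewrite inE; move: Av; rewrite KerE => /forallP/(_ p)/forallP; exact.
  have [vE Kv] : GLval (glmx (M + 1)) = M + 1 /\ glmx (M + 1) \in A.
    apply: (glmx_Ker cR) => //; rewrite addrK; apply/forallP => p; apply/forallP => q.
    by have /forallP/(_ q) := h p; rewrite inE.
  by exists (glmx (M + 1)); rewrite //= vE addrK.
rewrite card_mx_family; under eq_bigr do rewrite prod_nat_const card_ord.
by rewrite prod_nat_const card_ord -expnM.
Qed.

Lemma card_companion_class c0 :
  #|[set c | w ^+ m' *: c == w ^+ m' *: c0]| = (#|ideal w m| ^ n.-1.+1)%N.
Proof.
transitivity #|[set c : cVn | [forall p : 'I_n.-1.+1, forall q : 'I_1, c p q \in ideal w m]]|.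
  rewrite -[LHS](card_imset _ (addIr (- c0))); apply: eq_card => c; rewrite inE.
  have hE p : inI w m (c p 0) = (w ^+ m' * c p 0 == 0).
    by rewrite (inI_annE cR _ m_le_l).
  apply/imsetP/forallP => [[d /[1!inE] /eqP dc ->] p|h].
    apply/forallP => q; rewrite ord1 inE (inI_annE cR _ m_le_l).
    by move/matrixP/(_ p 0): dc; rewrite !mxE mulrBr => ->; rewrite subrr.
  exists (c + c0); last by rewrite addrK.
  rewrite inE; apply/eqP/matrixP => p q; rewrite !mxE ord1 mulrDr.
  by have /forallP/(_ 0) := h p; rewrite inE hE => /eqP->; rewrite add0r.
rewrite card_mx_family; under eq_bigr do rewrite big_ord1.
by rewrite prod_nat_const card_ord.
Qed.

Lemma card_cVn : #|{: cVn}| = (#|{: R}| ^ n.-1.+1)%N.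
Proof. by rewrite card_mx muln1. Qed.

Lemma coefA_congr i y y' : w ^+ m' *: y = w ^+ m' *: y' -> coefA i y = coefA i y'.
Proof.
move=> yy'; rewrite !coefAE; congr (_ * _); apply: eq_bigr => v Av; congr (_ * _^*).
apply: (phix_congr phi cR Av); rewrite ?leq_subr // lm' (mx_inI_annE cR _ m_le_l).
by rewrite scalerBr yy' subrr.
Qed.

(** By [coefA_companion_inj], a single class modulo w^m contributes to [whittaker_sum]; what remains
    is a computation of orders. *)
Lemma whittaker_coefA i c : coefA i (companion c) != 0 ->
  whittaker i * #|strict_upper_set m|%:R = coefA i (companion c) * #|strict_upper_set m'|%:R.
Proof.
move=> ci; have sumE : \sum_c' coefA i (companion c') =
    (#|ideal w m| ^ n.-1.+1)%:R * coefA i (companion c).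
  rewrite -(card_companion_class c) mulr_natl -sumr_const.
  rewrite (bigID (fun c' => w ^+ m' *: c' == w ^+ m' *: c)) /= [X in _ + X]big1 ?addr0.
    apply: eq_big => c'; first by rewrite inE.
    move=> /eqP cc'; apply: coefA_congr; apply/matrixP => p q; rewrite !mxE.
    by case: eqP => // _; move/matrixP/(_ p 0): cc'; rewrite !mxE.
  by move=> c'; apply: contraNeq => c'i; apply/eqP; apply: coefA_companion_inj c'i ci.
have Q0 : #|ideal w m|%:R != 0 :> algC by rewrite pnatr_eq0 -lt0n card_ideal_gt0.
have Q'0 : #|ideal w m'|%:R != 0 :> algC by rewrite pnatr_eq0 -lt0n card_ideal_gt0.
rewrite whittaker_sum sumE !card_strict_upper card_U card_cVn card_A upairsE.
rewrite -(card_ideal_mul cR m_le_l).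
rewrite -addnn !natrX natrM !exprD !exprMn.
by field; rewrite !expf_neq0.
Qed.

(** * The stabiliser of the character of a companion matrix *)

Section Stabiliser.
Variable c : cVn.
Local Notation x := (companion c : Mn).
Local Notation s := (hankel c : Mn).
Local Notation tau := (gl_tau s).
Hypothesis tauG : {in G, forall g, tau g \in G}.

Definition stab := [set g in G | mx_inI w m (GLval g *m x *m invmx (GLval g) - x)].
(** The union of the [tau]-stable cosets of [A] in [stab], by [tau_quot_A]. *)
Definition stab_sym := [set g in stab | mx_inI w m' (GLval g - GLval (tau g))].

Let sU : s \in unitmx := hankel_unit c.
Let s_sym : s^T = s := hankel_sym c.
Let tauM g h : tau (g * h)%g = (tau h * tau g)%g. Proof. exact: gl_tauM. Qed.
Let tauK : involutive tau. Proof. exact: gl_tauK. Qed.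

Lemma mem_stab g : (g \in stab) =
  (g \in G) && (w ^+ m' *: (GLval g *m x) == w ^+ m' *: (x *m GLval g)).
Proof.
rewrite inE (mx_inI_annE cR _ m_le_l).
congr (_ && _); rewrite -[RHS]subr_eq0 -scalerBr.
apply/eqP/eqP => e.
  have := congr1 (fun M => M *m GLval g) e; rewrite mul0mx -scalemxAl mulmxBl.
  by rewrite (mulmxKV (GLval_unit g)).
have := congr1 (fun M => M *m invmx (GLval g)) e; rewrite mul0mx -scalemxAl mulmxBl.
by rewrite (mulmxK (GLval_unit g)).
Qed.

Lemma tau_companion : mx_tau s x = x.
Proof.
rewrite /mx_tau -{1}s_sym -trmx_mul companion_hankel_sym -mulmxA mulmxV //.
by rewrite mulmx1.
Qed.

(** Here [z] is the polynomial in [x] whose coefficients form the first column of [g]. It has the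
    same first column as [g], and both commute with [x] modulo w^m; polynomials in [x] are fixed by
    [tau] because [x] is. *)
Lemma stab_centraliser g : g \in stab ->
  exists z, [/\ z *m x = x *m z, mx_tau s z = z & mx_inI w m (GLval g - z)].
Proof.
rewrite mem_stab => /andP[_ /eqP gx].
pose z : Mn := \sum_(k < n.-1.+1) GLval g k ord0 *: x ^+ k.
have zx : z *m x = x *m z.
  rewrite mulmx_suml mulmx_sumr; apply: eq_bigr => k _.
  by rewrite -scalemxAl -scalemxAr !mulmxE -exprS -exprSr.
exists z; split=> //.
  rewrite /mx_tau /z linear_sum mulmx_sumr mulmx_suml; apply: eq_bigr => k _.
  rewrite linearZ /= -scalemxAr -scalemxAl; congr (_ *: _).
  rewrite -[LHS]/(mx_tau s _); elim: (k : nat) => [|j IH]; first by rewrite expr0 (mx_tau1 sU).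
  by rewrite exprS -mulmxE (mx_tauM sU) IH tau_companion mulmxE -exprSr exprS.
rewrite (mx_inI_annE cR _ m_le_l).
apply/eqP; apply: (comm_hessenberg0 (companion_hessenberg c)) => [|i].
  by rewrite -scalemxAr -scalemxAl mulmxBl mulmxBr zx !scalerBr gx.
rewrite !mxE summxE (bigD1 i) //= mxE companionX_col0 eqxx mulr1 big1 ?addr0 ?subrr ?mulr0 //.
by move=> k ki; rewrite mxE companionX_col0 eq_sym (negPf ki) mulr0.
Qed.

Lemma stab_congr g g' : g \in stab -> mx_inI w m (GLval g' - GLval g) -> g' \in stab.
Proof.
move=> gS gg'.
have gg'E : w ^+ m' *: GLval g' = w ^+ m' *: GLval g.
  by apply/eqP; rewrite -subr_eq0 -scalerBr -(mx_inI_annE cR _ m_le_l).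
move: gS; rewrite !mem_stab => /andP[Gg /eqP gx]; apply/andP; split.
  rewrite -(mulKVg g g') groupM // (subsetP K1G) // (subsetP (Ker_sub _ _ m_gt0)) //.
  rewrite KerE GLvalM GLvalV.
  suff -> : invmx (GLval g) *m GLval g' - 1 = invmx (GLval g) *m (GLval g' - GLval g).
    exact: mx_inIMl.
  by rewrite mulmxBr GLvalVK.
by rewrite scalemxAl gg'E -scalemxAl gx !scalemxAr gg'E.
Qed.

Lemma A_mul_congr g v : v \in A -> mx_inI w m (GLval (g * v)%g - GLval g).
Proof.
rewrite KerE => Av; rewrite GLvalM -[X in _ - X]mulmx1 -mulmxBr mx_inIMl //.
exact: mx_inI_leq Av.
Qed.

Lemma stab_mulA g v : v \in A -> ((g * v)%g \in stab) = (g \in stab).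
Proof.
move=> Av; apply/idP/idP => [gvS|gS]; last exact: stab_congr (A_mul_congr g Av).
by apply: (stab_congr gvS); rewrite -opprB mx_inIN A_mul_congr.
Qed.

Lemma phixV y v : v \in A -> phix_fun phi y v^-1%g = (phix_fun phi y v)^*.
Proof.
move=> Av; have AvV := groupVr Av.
apply: (mulIf (phi_neq0 phi_add (\tr (y *m (GLval v - 1))))).
rewrite -[phi (\tr _)]/(phix_fun phi y v) -(phixM cR phi_add y l2m' AvV Av) mulVg phix1 //.
by rewrite mulrC -normCK norm_phi ?expr1n.
Qed.

Lemma tau_A v : v \in A -> tau v \in A.
Proof.
rewrite !KerE (gl_tauE sU) => Av; rewrite -(mx_tau1 sU) -mx_tauB.
exact: mx_inI_tau.
Qed.

Lemma phix_tau v : phix_fun phi x (tau v) = phix_fun phi x v.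
Proof.
rewrite /phix_fun (gl_tauE sU) -[in LHS](mx_tau1 sU) -mx_tauB -{1}tau_companion -(mx_tauM sU).
by rewrite (mxtrace_tau sU) mxtrace_mulC.
Qed.

Lemma tau_quot_A g : ((g * (tau g)^-1)%g \in A) = mx_inI w m' (GLval g - GLval (tau g)).
Proof.
rewrite KerE GLvalM GLvalV.
have e : GLval g *m invmx (GLval (tau g)) - 1 =
    (GLval g - GLval (tau g)) *m invmx (GLval (tau g)).
  by rewrite mulmxBl GLvalKV.
apply/idP/idP => [|h]; last by rewrite e mx_inIMr.
rewrite e => /(mx_inIMr (GLval (tau g))).
by rewrite (mulmxKV (GLval_unit _)).
Qed.

(** As [g - tau g] vanishes modulo w^m' and [tau g] is congruent to [z] modulo w^m, the quotient is
    1 + (g - tau g) z^-1. The matrix z^-1 x is fixed by [tau], so its products with [g] and with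
    [tau g] have the same trace. *)
Lemma phix_stab_sym g : g \in stab_sym -> phix_fun phi x (g * (tau g)^-1)%g = 1.
Proof.
rewrite inE => /andP[gS g_tau]; have [z [zx tz gz]] := stab_centraliser gS.
have zU : z \in unitmx.
  suff : invmx (GLval g) *m z \is a GRing.unit.
    by rewrite -[_ \is a _]/(_ \in unitmx) unitmx_mul => /andP[].
  apply: (mx_inI1_unit cR).
  have -> : invmx (GLval g) *m z - 1 = - (invmx (GLval g) *m (GLval g - z)).
    by rewrite mulmxBr GLvalVK opprB.
  by rewrite mx_inIN mx_inIMl //; apply: mx_inI_leq gz.
have tgz : mx_inI w m (GLval (tau g) - z).
  by rewrite (gl_tauE sU) -tz -mx_tauB; apply: mx_inI_tau.
pose E := GLval g - GLval (tau g).
have Ez : E *m invmx (GLval (tau g)) = E *m invmx z.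
  apply/eqP; rewrite -subr_eq0 -mulmxBr; apply/eqP.
  have -> : invmx (GLval (tau g)) - invmx z =
      invmx (GLval (tau g)) *m ((z - GLval (tau g)) *m invmx z).
    by rewrite mulmxBl mulmxV // mulmxBr mulmx1 mulmxA GLvalVK mul1mx.
  apply: (mx_inIM_eq0 cR l_le_m'm g_tau).
  by rewrite mx_inIMl // mx_inIMr // -opprB mx_inIN.
rewrite /phix_fun GLvalM GLvalV.
have -> : GLval g *m invmx (GLval (tau g)) - 1 = E *m invmx z.
  by rewrite -Ez /E mulmxBl GLvalKV.
rewrite mulmxA mxtrace_mulC mulmxA /E mulmxBr raddfB /=.
have xz : mx_tau s (invmx z *m x) = invmx z *m x.
  have tzV : mx_tau s (invmx z) = invmx z.
    rewrite -[LHS]mulmx1 -(mulmxV zU) mulmxA -{2}tz -(mx_tauM sU) mulmxV // (mx_tau1 sU).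
    by rewrite mul1mx.
  rewrite (mx_tauM sU) tau_companion tzV -[LHS]mul1mx -(mulVmx zU) -!mulmxA.
  by congr (_ *m _); rewrite mulmxA zx mulmxK.
rewrite [X in _ - X](_ : _ = \tr (mx_tau s (GLval g *m (invmx z *m x)))).
  by rewrite (mxtrace_tau sU) mxtrace_mulC subrr phi0.
by rewrite (mx_tauM sU) xz gl_tauE.
Qed.

(** For [g] outside [stab], the sum over the coset of [g] is a multiple of the inner product of two
    distinct linear characters of [A]. *)
Lemma sum_tau_quot : \sum_(g in G | (g * (tau g)^-1)%g \in A) phix_fun phi x (g * (tau g)^-1)%g =
  #|stab_sym|%:R.
Proof.
rewrite (bigID (mem stab)) /= [X in _ + X](_ : _ = 0) ?addr0.
  rewrite -sumr_const; apply: eq_big => g.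
    rewrite tau_quot_A [RHS]inE andbC.
    by case: (boolP (g \in stab)) => //= /[1!inE] /andP[->].
  move=> /andP[/andP[_ gA] gS]; apply: phix_stab_sym.
  by rewrite inE gS -tau_quot_A.
set T := (X in X = 0).
have nA0 : #|A|%:R != 0 :> algC by rewrite neq0CG.
apply: (mulfI nA0); rewrite mulr0 mulr_natl -sumr_const.
pose P g := ((g \in G) && ((g * (tau g)^-1)%g \in A)) && (g \notin stab).
have qE g v : (g * v * (tau (g * v))^-1 = v ^ g^-1 * (g * (tau g)^-1) * (tau v)^-1)%g.
  by rewrite tauM invMg conjgE invgK !mulgA mulgKV.
transitivity (\sum_(g | P g) \sum_(v in A) phix_fun phi x (g * v * (tau (g * v))^-1)%g).
  rewrite [RHS]exchange_big /=; apply: eq_bigr => v Av; rewrite /T (reindex_inj (mulIg v)) /=.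
  apply: eq_bigl => g; rewrite /P stab_mulA // qE [(_ * (tau v)^-1 \in A)%g]groupMr ?groupV ?tau_A //.
  have Gv := subsetP A_sub_G _ Av; rewrite (groupMr _ Gv).
  by rewrite [((v ^ g^-1)%g * _ \in A)%g]groupMl ?KerJ.
apply: big1 => g /andP[/andP[Gg gA] gS].
have gx_neq : mkCF A (phix_fun phi (invmx (GLval g) *m x *m GLval g)) != mkCF A (phix_fun phi x).
  apply: contra gS => /eqP e; have : mx_inI w m (invmx (GLval g) *m x *m GLval g - x).
    rewrite -lm'; apply: (phix_inj cR phi_add phi_prim m'_bounds).
    by move=> v Av; have := congr1 (fun f : 'CF(A) => f v) e; rewrite !psiE Av.
  move=> h; rewrite mem_stab Gg /=; apply/eqP/esym/eqP.
  rewrite -subr_eq0 -scalerBr.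
  have -> : x *m GLval g - GLval g *m x = GLval g *m (invmx (GLval g) *m x *m GLval g - x).
    by rewrite mulmxBr !mulmxA GLvalKV mul1mx.
  by rewrite -(mx_inI_annE cR _ m_le_l) mx_inIMl.
transitivity (phix_fun phi x (g * (tau g)^-1)%g * (#|A|%:R *
    '[mkCF A (phix_fun phi (invmx (GLval g) *m x *m GLval g)), mkCF A (phix_fun phi x)])).
  rewrite cfdotE mulVKf // mulr_sumr; apply: eq_bigr => v Av.
  move: gA; rewrite qE; move: (g * _)%g => q qA.
  have vgA : (v ^ g^-1)%g \in A by rewrite KerJ.
  have tvA := groupVr (tau_A Av).
  rewrite (phixM cR phi_add x l2m' (groupM vgA qA) tvA) (phixM cR phi_add x l2m' vgA qA).
  rewrite phixV ?tau_A // phix_tau phixJ GLvalV invmxK !psiE Av; ring.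
by rewrite cfdot_lin_char // (negPf gx_neq) !mulr0.
Qed.

(** The inner product of [tau_count] with the character induced from phi_x is given by
    [sum_tau_quot]; expanded over irreducibles it is bounded by means of [norm_cfdot_tau_count]. *)
Lemma card_stab_sym_le :
  (#|stab_sym|%:R <= #|A|%:R * \sum_i coefA i x :> algC).
Proof.
have nA0 : #|A|%:R != 0 :> algC by rewrite neq0CG.
have : '['Ind[G] (mkCF A (phix_fun phi x)), tau_count G tau] = #|A|%:R^-1 * #|stab_sym|%:R.
  rewrite -cfdot_Res_r cfdotE; congr (_ * _); rewrite -sum_tau_quot.
  transitivity (\sum_(a in A) \sum_(g in G) phix_fun phi x a * (g * (tau g)^-1 == a)%g%:R).
    apply: eq_bigr => a Aa; rewrite psiE Aa cfResE ?A_sub_G // tau_countE ?(subsetP A_sub_G) //.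
    by rewrite rmorph_sum mulr_sumr; apply: eq_bigr => g _; rewrite rmorph_nat.
  rewrite exchange_big /= [RHS]big_mkcondr /=; apply: eq_bigr => g Gg.
  case: ifP => [gA|/negP gA].
    rewrite (bigD1 _ gA) /= eqxx mulr1 big1 ?addr0 // => a /andP[_].
    by rewrite eq_sym => /negPf->; rewrite mulr0.
  by rewrite big1 // => a Aa; case: eqP => [e|_]; rewrite ?mulr0 //; case: gA; rewrite e.
rewrite cfdot_sum_irr => /(congr1 ( *%R #|A|%:R)); rewrite mulVKf // => e.
rewrite -[leLHS]normr_nat -e normrM normr_nat ler_wpM2l ?ler0n //.
apply: le_trans (ler_norm_sum _ _ _) _; apply: ler_sum => i _.
rewrite -cfdot_Res_r cfdotC -/(coefA i x) [X in _ * X^*]cfdotC conjCK.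
rewrite normrM norm_conjC [`|coefA i x|]ger0_norm ?natr_ge0 ?coefA_nat //.
by rewrite ler_piMr ?natr_ge0 ?coefA_nat // norm_cfdot_tau_count.
Qed.

Lemma strict_upper_inI (k : nat) M : M \in strict_upper_set k -> mx_inI w k M.
Proof.
rewrite inE => /forallP M_up; apply/forallP => p; apply/forallP => q.
have /forallP/(_ q) := M_up p; case: ifP => _; rewrite inE // => /eqP->.
exact: inI0.
Qed.

Lemma strict_upperD (k : nat) M M' :
  M \in strict_upper_set k -> M' \in strict_upper_set k -> M + M' \in strict_upper_set k.
Proof.
rewrite !inE => /forallP M_up /forallP M'_up; apply/forallP => p; apply/forallP => q.
have /forallP/(_ q) := M_up p; have /forallP/(_ q) := M'_up p; rewrite mxE.
case: ifP => _; rewrite !inE; last by move=> /eqP-> /eqP->; rewrite addr0.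
by move=> Mi M'i; apply: inID.
Qed.

Lemma strict_upper_sub (k k' : nat) : (k <= k')%N -> strict_upper_set k' \subset strict_upper_set k.
Proof.
move=> kk'; apply/subsetP => M; rewrite !inE => /forallP M_up.
apply/forallP => p; apply/forallP => q; have /forallP/(_ q) := M_up p.
case: ifP => // _; rewrite !inE => /existsP[r /eqP->]; apply/existsP.
by exists (w ^+ (k' - k) * r); rewrite mulrA -exprD subnKC.
Qed.

(** Equal to [(M - mx_tau s M) *m s], hence zero exactly when [M] is fixed by [mx_tau s]. *)
Let skew M : Mn := M *m s - (M *m s)^T.
Let upper M : Mn := \matrix_(p, q) if (p < q)%N then M p q else 0.

Lemma stab_upper_skew g : g \in stab -> upper (skew (GLval g)) \in strict_upper_set m.
Proof.
move=> /stab_centraliser[z [_ tz gz]].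
have skew_z : skew z = 0.
  by rewrite /skew trmx_mul s_sym -{1}tz /mx_tau mulmxKV // subrr.
have skew_m : mx_inI w m (skew (GLval g)).
  have -> : skew (GLval g) = skew (GLval g - z).
    rewrite -[LHS]subr0 -[X in _ - X]skew_z /skew mulmxBl [(_ - _)^T]linearB /=.
    by rewrite !opprD addrACA.
  by rewrite mx_inIB ?mx_inI_tr // mx_inIMr.
rewrite inE; apply/forallP => p; apply/forallP => q; rewrite mxE; case: ifP => _.
  by rewrite inE; move/forallP/(_ p)/forallP: skew_m; exact.
by rewrite inE.
Qed.

Lemma skew_upper M : skew M - upper (skew M) + (upper (skew M))^T = 0.
Proof.
apply/matrixP => p q; rewrite [LHS]mxE [(skew M - _) p q]mxE !mxE.
by case: ltngtP => [_|_|/val_inj->]; rewrite ?subrr ?addr0 ?oppr0 ?addr0 //; ring.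
Qed.

(** The map [F] is injective. Subtracting the upper half of the skew part of [p.1] makes it fixed by
    [tau], and the extra term [p.2] disturbs this only modulo w^m'. From [M p] and [N p] one
    recovers [p.1], then [p.2]. *)
Lemma card_stab_le :
  (#|stab| * #|strict_upper_set m'| <= #|stab_sym| * #|strict_upper_set m|)%N.
Proof.
pose N (p : GLn * Mn) := upper (skew (GLval p.1)) + p.2.
pose M (p : GLn * Mn) := GLval p.1 - N p *m invmx s.
pose F p := (glmx (M p), N p).
rewrite -!cardsX.
have NP p : p \in setX stab (strict_upper_set m') -> N p \in strict_upper_set m.
  rewrite inE => /andP[pS pN]; apply: strict_upperD; first exact: stab_upper_skew.
  exact: (subsetP (strict_upper_sub m_le_m')).
have Mm p : p \in setX stab (strict_upper_set m') -> mx_inI w m (M p - GLval p.1).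
  move=> /NP/strict_upper_inI Np.
  by rewrite /M addrAC subrr add0r mx_inIN mx_inIMr.
have ME p : p \in setX stab (strict_upper_set m') -> GLval (glmx (M p)) = M p.
  move=> /Mm Mp; apply: glmxK; suff : invmx (GLval p.1) *m M p \is a GRing.unit.
    by rewrite -[_ \is a _]/(_ \in unitmx) unitmx_mul => /andP[].
  apply: (mx_inI1_unit cR); apply: (mx_inI_leq m_gt0).
  suff -> : invmx (GLval p.1) *m M p - 1 = invmx (GLval p.1) *m (M p - GLval p.1).
    exact: mx_inIMl.
  by rewrite [RHS]mulmxBr GLvalVK.
have F_inj : {in setX stab (strict_upper_set m') &, injective F}.
  move=> p q pX qX /eqP/andP[/eqP Mpq /eqP Npq].
  rewrite /= in Mpq Npq; have {}Mpq : M p = M q by rewrite -ME // Mpq ME.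
  have pq1 : p.1 = q.1.
    by apply: GLval_inj; rewrite -[LHS](subrK (N p *m invmx s)) -/(M p) Mpq Npq subrK.
  apply: injective_projections => //.
  by move: Npq; rewrite /= /N pq1 => /addrI.
rewrite -(card_in_imset F_inj); apply/subset_leq_card/subsetP => _ /imsetP[p pX ->].
rewrite inE /= NP // andbT inE; have pS : p.1 \in stab by move: pX; rewrite inE => /andP[].
rewrite (stab_congr pS) ?ME ?Mm //= (gl_tauE sU) ME //.
have -> : M p - mx_tau s (M p) = skew (M p) *m invmx s.
  by rewrite /skew mulmxBl mulmxK // trmx_mul s_sym.
apply: mx_inIMr.
have -> : skew (M p) = p.2^T - p.2.
  transitivity (skew (GLval p.1) - N p + (N p)^T).
    by rewrite /skew /M mulmxBl mulmxKV // linearB /= opprB !addrA [LHS]addrAC; congr (_ + _); rewrite addrAC.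
  rewrite -[RHS]add0r -(skew_upper (GLval p.1)) /N; set W := upper _.
  by rewrite [(_ + _)^T]linearD /= opprD !addrA [_ - p.2 + _]addrAC [LHS]addrAC.
have : p.2 \in strict_upper_set m' by move: pX; rewrite inE => /andP[].
by move=> /strict_upper_inI p2; rewrite mx_inIB ?mx_inI_tr.
Qed.

Lemma sum_coefA_sqr : #|A|%:R * \sum_i coefA i x ^+ 2 = #|stab|%:R.
Proof.
under eq_bigr do rewrite expr2; rewrite sum_coefA_mul mulVKf ?neq0CG //.
rewrite -sum1_card natr_sum big_mkcond [RHS]big_mkcond /=; apply: eq_bigr => g _.
by rewrite inE; case: (g \in G) => //=; case: (mx_inI _ _ _).
Qed.

(** With k the multiplicity of phi_x in a character, the terms k (k e - d) are nonnegative and their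
    sum is at most 0, so each of them vanishes. *)
Lemma whittaker_companion i : coefA i x != 0 -> whittaker i = 1.
Proof.
set d : algC := #|strict_upper_set m|%:R; set e : algC := #|strict_upper_set m'|%:R.
have su_gt0 (k : nat) : 0 < #|strict_upper_set k|%:R :> algC.
  by rewrite ltr0n card_strict_upper expn_gt0 card_ideal_gt0.
have k_ge0 j : 0 <= coefA j x by rewrite natr_ge0 ?coefA_nat.
(* If k is nonzero, then so is the natural number [whittaker j], whence d <= k e. *)
have term_ge0 j : 0 <= coefA j x * (coefA j x * e - d).
  have [->|kj] := eqVneq (coefA j x) 0; first by rewrite mul0r.
  rewrite mulr_ge0 // subr_ge0 -(whittaker_coefA kj) ler_peMl ?(ltW (su_gt0 _)) //.
  have /natrP[r rE] := whittaker_nat j; rewrite rE ler1n lt0n -(pnatr_eq0 algC) -rE.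
  apply/eqP => w0; have := whittaker_coefA kj; rewrite w0 mul0r => /esym/eqP.
  by rewrite mulf_eq0 (negPf kj) (gt_eqF (su_gt0 _)).
(* [sum_coefA_sqr] turns the squares into |stab|; then |stab| e <= |stab_sym| d and |stab_sym| is at
   most |A| times the sum of the k. *)
have sum_le0 : \sum_j coefA j x * (coefA j x * e - d) <= 0.
  under eq_bigr do rewrite mulrBr mulrA -expr2.
  rewrite sumrB -!mulr_suml subr_le0 -(@ler_pM2l _ #|A|%:R) ?gt0CG //.
  rewrite !mulrA sum_coefA_sqr.
  apply: le_trans (_ : #|stab_sym|%:R * d <= _); last by rewrite ler_wpM2r ?(ltW (su_gt0 _)) ?card_stab_sym_le.
  by rewrite -!natrM ler_nat card_stab_le.
move=> ki; have /eqP : \sum_j coefA j x * (coefA j x * e - d) = 0.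
  by apply/le_anti; rewrite sum_le0 sumr_ge0.
rewrite psumr_eq0 // => /allP/(_ i (mem_index_enum i)) /=.
rewrite mulf_eq0 (negPf ki) subr_eq0 -(whittaker_coefA ki) => /eqP wd.
by apply: (mulIf (lt0r_neq0 (su_gt0 m))); rewrite mul1r.
Qed.
End Stabiliser.
End GelfandGraev.

(** * Twisting by the diagonal matrix with entries 1, a, ..., a *)

Section Twist.
Variables (n : nat) (R : finComUnitRingType) (w : R) (l : nat) (phi : R -> algC).
Hypotheses (n_gt1 : (1 < n)%N).
Hypotheses (cR : chain_ring w l) (phi_add : additive_char phi) (phi_prim : primitive_char w phi l).
Local Notation GLn := {'GL_n[R]}.
Local Notation Mn := 'M[R]_n.-1.+1.
Local Notation cVn := 'cV[R]_n.-1.+1.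
Local Notation K i := (Ker_group n w i).
Local Notation U := (U_group n R).
Local Notation A := (Ker_group n w (l - l./2)).
Variable a : R.
Hypothesis aU : a \is a GRing.unit.

Definition twist_coef (i : 'I_n.-1.+1) : R := if i == ord0 then 1 else a.
Definition twist : GLn := glmx (diag_mx (\row_i twist_coef i)).
(** Conjugation by [twist] changes the subdiagonal 1, 1, ..., 1 into a, 1, ..., 1. *)
Definition alpha_companion (c : cVn) : Mn :=
  GLval twist *m companion c *m invmx (GLval twist).

Let twist_coefU i : twist_coef i \is a GRing.unit.
Proof. by rewrite /twist_coef; case: eqP; rewrite ?unitr1. Qed.

Lemma twistE : GLval twist = diag_mx (\row_i twist_coef i).
Proof.
apply: glmxK; rewrite -[_ \is a _]/(_ \in unitmx) unitmxE det_diag rpred_prod // => i _.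
by rewrite mxE.
Qed.

Lemma twistVE : invmx (GLval twist) = diag_mx (\row_i (twist_coef i)^-1).
Proof.
rewrite -[RHS]mul1mx -(GLvalVK twist) -mulmxA twistE.
have -> : diag_mx (\row_i twist_coef i) *m diag_mx (\row_i (twist_coef i)^-1) = 1%:M :> Mn.
  rewrite mul_mx_diag; apply/matrixP => i j; rewrite !mxE.
  by have [->|_] := eqVneq i j; rewrite ?mul0r ?mulr1n ?mulrV.
by rewrite mulmx1.
Qed.

Lemma twist_conjE M i j :
  (GLval twist *m M *m invmx (GLval twist)) i j = twist_coef i * M i j / twist_coef j.
Proof. by rewrite twistVE mul_mx_diag mxE twistE mul_diag_mx !mxE. Qed.

Lemma theta_funE u : unitriangular (GLval u) ->
  theta_fun phi a u = phix_fun phi (alpha_companion 0) u.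
Proof.
move=> uT; rewrite /theta_fun /phix_fun; congr phi.
(* The coefficient [a] is absorbed into the term [k = 0] of a sum over the whole superdiagonal;
   [n_gt1] makes that term present. *)
pose F k : R := (if k == 0%N then a else 1) * GLval u (inord k) (inord k.+1).
transitivity (\sum_(0 <= k < n.-1) F k).
  rewrite [RHS]big_ltn; last by rewrite -ltnS prednK ?(ltnW n_gt1).
  rewrite /F /=; congr (_ * GLval u _ _ + _); first by apply: val_inj; rewrite /= inordK.
  by rewrite big_nat [RHS]big_nat; apply: eq_bigr => -[|k] // _; rewrite mul1r.
rewrite big_mkord [RHS]big_ord_recl [X in _ = X + _]mxE [X in _ = X + _]big1 ?add0r => [|j _]; last first.
  by rewrite twist_conjE !mxE; case: eqP => _; rewrite ?mxE mulr0 !mul0r.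
apply: eq_bigr => k _; rewrite mxE.
pose k0 : 'I_n.-1.+1 := inord k.
have k0E : k0 = k :> nat by rewrite inordK // ltnS ltnW.
have k1E : inord k.+1 = lift ord0 k :> 'I_n.-1.+1.
  by apply: val_inj; rewrite /= inordK ?ltnS.
rewrite (bigD1 k0) //= big1 ?addr0 => [|j jk].
  have -> : alpha_companion 0 (lift ord0 k) k0 = if k == 0%N :> nat then a else 1.
    rewrite twist_conjE mxE -val_eqE /= k0E ltn_eqF // /bump leq0n add1n eqxx mulr1.
    rewrite /twist_coef -!val_eqE /= k0E; case: (k : nat) => [|k']; rewrite /= ?divr1 ?divrr //.
  have -> : (GLval u - 1) k0 (lift ord0 k) = GLval u k0 (lift ord0 k).
    by rewrite !mxE -val_eqE /= k0E /bump leq0n add1n ltn_eqF ?subr0.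
  by rewrite /F k1E.
rewrite twist_conjE !mxE; case: eqP => [_|_]; first by rewrite ?mxE mulr0 !mul0r.
rewrite (_ : (_ == _) = false) ?mulr0 ?mul0r //; apply: contraNF jk => /eqP[jE].
by rewrite -val_eqE /= k0E -jE.
Qed.

Variable G : {group GLn}.
Hypotheses (K1G : K 1 \subset G) (UG : U \subset G).
Hypothesis tauG : forall s, s \in unitmx -> {in G, forall g, gl_tau s g \in G}.
Hypothesis twist_norm : (twist \in 'N(G))%g.

Lemma twistU u : ((u ^ twist)%g \in U) = (u \in U).
Proof.
have conjU (d e : 'I_n.-1.+1 -> R) (v v' : GLn) : (forall i, d i * e i = 1) ->
    (forall i j, GLval v' i j = d i * GLval v i j * e j) -> v \in U -> v' \in U.
  move=> de vE /UP vT; apply/UP => i j ji; rewrite vE vT //.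
  by have [->|] := eqVneq i j; rewrite ?mulr1 ?de // mulr0 mul0r.
apply/idP/idP.
  apply: (conjU twist_coef (fun i => (twist_coef i)^-1)) => [i|i j]; first by rewrite mulrV.
  rewrite -[in LHS](conjgK twist u); set v := (u ^ twist)%g.
  by rewrite conjgE invgK mulgA !GLvalM GLvalV twist_conjE.
apply: (conjU (fun i => (twist_coef i)^-1) twist_coef) => [i|i j]; first by rewrite mulVr.
rewrite conjgE mulgA !GLvalM GLvalV twistVE twistE mul_mx_diag mxE mul_diag_mx !mxE.
by [].
Qed.

Lemma theta_phix u : u \in U -> theta_fun phi a u = phix_fun phi (companion 0) (u ^ twist)%g.
Proof. by move=> /UP uT; rewrite theta_funE // phixJ. Qed.

Lemma theta_funM : {in U &, forall u v, theta_fun phi a (u * v)%g = theta_fun phi a u * theta_fun phi a v}.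
Proof.
move=> u v Uu Uv; rewrite !theta_phix ?groupM // conjMg.
by rewrite (phixM_U phi_add) // twistU.
Qed.

Lemma theta_fun1 : theta_fun phi a (1%g : GLn) = 1.
Proof. by rewrite theta_phix ?group1 // conj1g phix1. Qed.

(** Since [twist] normalises [G] without having to lie in it, ['chi_i] is replaced by its conjugate
    ['chi_j]; this carries theta_a to theta_1 and each [alpha_companion c] to [companion c]. *)
Lemma whittaker_alpha (i : Iirr G) :
  ('['Res[U] 'chi_i, theta n phi a] = 1 /\ exists c, coefA w l phi i (alpha_companion c) != 0) \/
  ('['Res[U] 'chi_i, theta n phi a] = 0 /\ forall c, coefA w l phi i (alpha_companion c) = 0).
Proof.
pose j := conjg_Iirr i twist.
have chiE v : 'chi_j (v ^ twist)%g = 'chi_i v.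
  by rewrite conjg_IirrE cfConjgEJ.
have coefE y : coefA w l phi j y = coefA w l phi i (GLval twist *m y *m invmx (GLval twist)).
  rewrite !(coefAE cR phi_add K1G UG); congr (_ * _).
  rewrite (reindex_inj (conjg_inj twist)) /=; apply: eq_big => v; first by rewrite KerJ.
  by move=> Av; rewrite chiE phixJ.
have whitE : '['Res[U] 'chi_i, theta n phi a] = whittaker phi j.
  rewrite (whittakerE phi_add UG) cfdotE; congr (_ * _).
  rewrite [RHS](reindex_inj (conjg_inj twist)) /=; apply: eq_big => u; first by rewrite twistU.
  move=> Uu; rewrite chiE cfResE // mkCFE; [|exact: theta_fun1|exact: theta_funM].
  by rewrite Uu theta_phix.
have core c := whittaker_companion cR phi_add phi_prim K1G UG (tauG (hankel_unit c)) (i:=j).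
have [/existsP[c cj]|/existsPn no_c] := boolP [exists c, coefA w l phi j (companion c) != 0].
  by left; rewrite whitE (core c) //; split=> //; exists c; rewrite -coefE.
right; have no_c' c : coefA w l phi j (companion c) = 0 by apply/eqP; rewrite -[_ == _]negbK.
split=> [|c]; last by rewrite -coefE.
by rewrite whitE (whittaker_sum cR phi_add phi_prim K1G UG) big1 ?mulr0.
Qed.
End Twist.

(** * From SL_n to the matrices of determinant 1 modulo w *)

Section SpecialLinear.
Variables (n : nat) (R : finComUnitRingType) (w : R) (l : nat).
Hypotheses (cR : chain_ring w l) (nU : n.-1.+1%:R \is a @GRing.unit R).
Local Notation GLn := {'GL_n[R]}.
Local Notation Mn := 'M[R]_n.-1.+1.
Local Notation N := n.-1.+1.

Lemma inI_prod_sub i (I : finType) (F F' : I -> R) :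
  (forall j, inI w i (F j - F' j)) -> inI w i (\prod_j F j - \prod_j F' j).
Proof.
move=> FF'; elim/big_rec2: _ => [|j x y _ xy]; first by rewrite subrr inI0.
have -> : F j * y - F' j * x = F j * (y - x) + (F j - F' j) * x by ring.
by apply: inID; [apply: inIMl | apply: inIMr].
Qed.

Lemma inI_det_sub i (M M' : Mn) : mx_inI w i (M - M') -> inI w i (\det M - \det M').
Proof.
move=> /forallP MM'; rewrite /determinant -sumrB; apply: inI_sum => s _.
rewrite -mulrBr; apply: inIMl; apply: inI_prod_sub => j.
by have /forallP/(_ (s j)) := MM' j; rewrite !mxE.
Qed.

(** The difference of the powers is [x - y] times a sum [s] congruent to [N] modulo w, hence a
    unit. *)
Lemma expr_inj1 i x y : (0 < i)%N -> inI w i (x - 1) -> inI w i (y - 1) ->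
  x ^+ N = y ^+ N -> x = y.
Proof.
move=> i0 x1 y1 xyN.
have le1 z : inI w i z -> inI w 1 z.
  move=> /existsP[c /eqP->]; apply/existsP; exists (w ^+ i.-1 * c).
  by rewrite mulrA -exprD add1n prednK.
have {}x1 := le1 _ x1; have {}y1 := le1 _ y1.
have xk1 k z : inI w 1 (z - 1) -> inI w 1 (z ^+ k - 1).
  move=> z1; elim: k => [|k IH]; first by rewrite subrr inI0.
  have -> : z ^+ k.+1 - 1 = z * (z ^+ k - 1) + (z - 1) by rewrite exprS; ring.
  by apply: inID => //; apply: inIMl.
pose s := \sum_(k < N) x ^+ (N.-1 - k) * y ^+ k.
have sU : s \is a GRing.unit.
  have NsU : N%:R^-1 * s \is a GRing.unit.
    apply: (chain_unit1 cR); have -> : N%:R^-1 * s - 1 = N%:R^-1 * (s - N%:R).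
      by rewrite mulrBr mulVr.
    apply: inIMl; rewrite -[N in N%:R]card_ord -sumr_const -sumrB; apply: inI_sum => k _.
    have -> : x ^+ (N.-1 - k) * y ^+ k - 1 = (x ^+ (N.-1 - k) - 1) * y ^+ k + (y ^+ k - 1) by ring.
    by apply: inID; [apply: inIMr; apply: xk1 | apply: xk1].
  by move: NsU; rewrite unitrMr // unitrV.
apply/eqP; rewrite -subr_eq0; apply/eqP; apply: (mulIr sU).
by rewrite mul0r -subrXX xyN subrr.
Qed.

(** An injective self-map of the finite set 1 + w^i R is surjective. *)
Lemma exists_root i d : (0 < i)%N -> inI w i (d - 1) ->
  exists2 r, inI w i (r - 1) & r ^+ N = d.
Proof.
move=> i0 d1; pose D := [set x | inI w i (x - 1)].
have f_inj : {in D &, injective (fun x => x ^+ N)}.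
  by move=> x y; rewrite !inE; apply: expr_inj1.
have fD : (fun x => x ^+ N) @: D = D.
  apply/eqP; rewrite eqEcard card_in_imset // leqnn andbT.
  apply/subsetP => _ /imsetP[x /[1!inE] x1 ->]; rewrite inE.
  elim: (N) => [|k IH]; first by rewrite subrr inI0.
  have -> : x ^+ k.+1 - 1 = x * (x ^+ k - 1) + (x - 1) by rewrite exprS; ring.
  by apply: inID => //; apply: inIMl.
have : d \in D by rewrite inE.
by rewrite -fD => /imsetP[r /[1!inE] r1 ->]; exists r.
Qed.

Definition scalar_set i : {set GLn} :=
  [set g : GLn | [exists r, inI w i (r - 1) && (GLval g == r%:M)]].

Lemma scalar_setP i g :
  reflect (exists2 r, inI w i (r - 1) & GLval g = r%:M) (g \in scalar_set i).
Proof.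
rewrite inE; apply: (iffP existsP) => [[r /andP[r1 /eqP gr]]|[r r1 gr]]; exists r => //.
by rewrite r1 gr eqxx.
Qed.

Lemma scalar_group_set i : group_set (scalar_set i).
Proof.
apply/group_setP; split; first by apply/scalar_setP; exists 1; rewrite ?subrr ?inI0.
move=> g h /scalar_setP[r r1 gr] /scalar_setP[r' r'1 hr]; apply/scalar_setP.
exists (r * r'); last by rewrite GLvalM gr hr -scalar_mxM.
have -> : r * r' - 1 = r * (r' - 1) + (r - 1) by ring.
by apply: inID => //; apply: inIMl.
Qed.
Canonical scalar_group i := Group (scalar_group_set i).

Lemma scalar_cent i g h : g \in scalar_set i -> (h ^ g)%g = h.
Proof.
move=> /scalar_setP[r _ gr]; apply: GLval_inj.
by rewrite conjgE !GLvalM gr scalar_mxC -gr GLvalV mulmxA GLvalVK mul1mx.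
Qed.

(** Dividing [g] by the scalar [N]-th root of its determinant gives the factor in SL_n; uniqueness
    of this root makes the intersection trivial. *)
Lemma dprod_SL_scalar (H : {group GLn}) i : (0 < i)%N -> scalar_group i \subset H ->
  (forall g, g \in H -> inI w i (\det (GLval g) - 1)) ->
  ((SL_group n R :&: H)%G \x scalar_group i = H)%g.
Proof.
move=> i0 ZH detH; rewrite dprodE.
- apply/eqP; rewrite eqEsubset mul_subG ?subsetIr //=; apply/subsetP => g Hg.
  have [r r1 rN] := exists_root i0 (detH g Hg).
  have rU : r%:M \is a @GRing.unit Mn.
    rewrite -[_ \is a _]/(_ \in unitmx) unitmxE det_scalar rN -unitmxE.
    exact: GLval_unit.
  have Zr : glmx r%:M \in scalar_group i by apply/scalar_setP; exists r; rewrite ?glmxK.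
  have Hgr : (g * (glmx r%:M)^-1)%g \in H by rewrite groupM // groupV (subsetP ZH).
  rewrite -(mulgKV (glmx r%:M) g) mem_mulg //; apply/setIP; split=> //; rewrite inE.
  rewrite GLvalM GLvalV det_mulmx det_inv glmxK // det_scalar rN mulrV //.
  by rewrite -unitmxE GLval_unit.
- apply/subsetP => g Zg; apply/centP => h _; apply/esym/commgP.
  by rewrite commgEl (scalar_cent h Zg) mulVg.
apply/trivgP/subsetP => g; rewrite !inE => /andP[/andP[/eqP g1 _] /existsP[r /andP[r1 /eqP gr]]].
apply/eqP/GLval_inj; rewrite gr GLval1.
have -> : r = 1; last by [].
apply: (expr_inj1 i0 r1); first by rewrite subrr inI0.
by rewrite expr1n -g1 gr det_scalar.
Qed.

Definition det1_set : {set GLn} := [set g : GLn | inI w 1 (\det (GLval g) - 1)].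

Lemma det1_group_set : group_set det1_set.
Proof.
apply/group_setP; split; first by rewrite inE GLval1 det1 subrr inI0.
move=> g h; rewrite !inE GLvalM det_mulmx => g1 h1.
have -> : \det (GLval g) * \det (GLval h) - 1 =
  \det (GLval g) * (\det (GLval h) - 1) + (\det (GLval g) - 1) by ring.
by apply: inID => //; apply: inIMl.
Qed.
Canonical det1_group := Group det1_group_set.

Lemma Ker_det i g : g \in Ker_group n w i -> inI w i (\det (GLval g) - 1).
Proof. by rewrite KerE => /inI_det_sub; rewrite det1. Qed.

Lemma scalar_sub_Ker i : scalar_group i \subset Ker_group n w i.
Proof.
apply/subsetP => g /scalar_setP[r /existsP[c /eqP r1] gr]; rewrite KerE gr.
apply/mx_inIP; exists c%:M; rewrite scale_scalar_mx -r1.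
by rewrite raddfB.
Qed.

Lemma scalar_sub i j : (i <= j)%N -> scalar_group j \subset scalar_group i.
Proof.
move=> ij; apply/subsetP => g /scalar_setP[r /existsP[c /eqP r1] gr]; apply/scalar_setP.
exists r => //; rewrite r1; apply/existsP; exists (w ^+ (j - i) * c).
by rewrite mulrA -exprD subnKC.
Qed.

Lemma dprod_Ker i : (0 < i)%N ->
  (Kgroup n w SLt i \x scalar_group i = Ker_group n w i)%g.
Proof. by move=> i0; apply: dprod_SL_scalar (scalar_sub_Ker i) _ => // g; apply: Ker_det. Qed.

Lemma dprod_det1 : (Ggroup n R SLt \x scalar_group 1 = det1_group)%g.
Proof.
rewrite -[RHS](dprod_SL_scalar (i := 1)) //; first last.
- by move=> g; rewrite inE.
- by apply/subsetP => g /(subsetP (scalar_sub_Ker 1))/Ker_det; rewrite inE.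
congr (_ \x _)%g; apply/esym/setIidPl/subsetP => g; rewrite !inE => /eqP->.
by rewrite subrr inI0.
Qed.
End SpecialLinear.

Lemma mkCF_dprod (gT : finGroupType) (H Z L : {group gT}) (HZL : (H \x Z = L)%g) (f : gT -> algC) :
    f 1%g = 1 -> {in L &, forall g h, f (g * h)%g = f g * f h} ->
    {in Z, forall z, f z = 1} ->
  mkCF L f = cfDprodl HZL (mkCF H f).
Proof.
move=> f1 fM fZ; have [_ HZ _ _] := dprodP HZL; have [HL ZL] := mulG_sub HZ.
apply/cfun_inP => g Lg; have /mulsgP[h z Hh Zz gE] : g \in (H * Z)%g by rewrite HZ.
have Lh := subsetP HL h Hh; have Lz := subsetP ZL z Zz.
rewrite gE cfDprodEl // !mkCFE //; last by move=> x y Hx Hy; apply: fM; apply: (subsetP HL).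
by rewrite -gE Lg Hh gE fM // [f z]fZ // mulr1.
Qed.

Section Extension.
Variables (n : nat) (R : finComUnitRingType) (w : R) (l : nat) (phi : R -> algC).
Hypotheses (cR : chain_ring w l) (phi_add : additive_char phi) (phi_prim : primitive_char w phi l).
Local Notation GLn := {'GL_n[R]}.
Local Notation Mn := 'M[R]_n.-1.+1.
Local Notation K i := (Ker_group n w i).
Local Notation U := (U_group n R).
Local Notation m' := (l - l./2)%N.

(** Brings GL_n and SL_n to a group containing [K 1]. For SL_n the character is extended trivially
    to the scalars congruent to 1 modulo w, and the last clause confines the phi_x that occur to
    traces vanishing modulo w^m. *)
Lemma irr_extension t (nU : t = SLt -> n.-1.+1%:R \is a @GRing.unit R) (i : Iirr (Ggroup n R t)) :
  exists (H : {group GLn}) (j : Iirr H),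
  [/\ K 1 \subset H, U \subset H,
      (forall s, s \in unitmx -> {in H, forall g, gl_tau s g \in H}),
      (forall d, (d \in 'N(H))%g) &
  [/\ 'Res[U] 'chi_j = 'Res[U] 'chi_i,
      (forall x, in_g t x ->
         '['Res[Kgroup n w t m'] 'chi_i, phix w phi t m' x] = coefA w l phi j x) &
      (forall x, t = SLt -> coefA w l phi j x != 0 -> w ^+ m' * \tr x = 0)]].
Proof.
have l2m' : (l <= m' + m')%N by have := odd_double_half l; lia.
have m'_gt0 : (0 < m')%N by have := chain_gt1 cR; have := odd_double_half l; lia.
case: t nU i => nU i.
  exists (Ggroup n R GLt), i; split; rewrite ?subsetT //.
  - by move=> s _ g _; rewrite inE.
  - by move=> d; rewrite inE; apply/subsetP => g _; rewrite inE.
  split=> // x _; rewrite /coefA /phix.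
  suff -> : Kgroup n w GLt m' = K m' by [].
  by apply/group_inj; rewrite /= setTI.
have {}nU := nU erefl; have dG := dprod_det1 cR nU; have dK := dprod_Ker cR nU m'_gt0.
have [_ /mulG_sub[SLG ZG] _ _] := dprodP dG.
have USL : U \subset Ggroup n R SLt.
  apply/subsetP => u /UP uT; rewrite inE -det_tr det_trig.
    by rewrite big1 // => p _; rewrite mxE uT ?eqxx.
  by apply/is_trig_mxP => p q pq; rewrite mxE uT ?(ltnW pq) // -val_eqE gtn_eqF.
have KG : K 1 \subset det1_group n w.
  by apply/subsetP => g /Ker_det; rewrite inE.
have KmG : K m' \subset det1_group n w by apply: subset_trans (Ker_sub n w m'_gt0) KG.
exists (det1_group n w), (dprodl_Iirr dG i); rewrite dprodl_IirrE.
split=> //; first exact: subset_trans USL SLG.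
- by move=> s sU g; rewrite !inE gl_tauE // det_tau.
- move=> d; rewrite inE; apply/subsetP => _ /imsetP[g + ->]; rewrite !inE => g1.
  rewrite conjgE !GLvalM GLvalV !det_mulmx mulrA [_ * _ * \det (GLval d)]mulrAC -det_mulmx.
  by rewrite GLvalVK det1 mul1r.
have resE (L : {group GLn}) : L \subset Ggroup n R SLt ->
    'Res[L] (cfDprodl dG 'chi_i) = 'Res[L] 'chi_i.
  by move=> LSL; rewrite -(cfResRes _ LSL SLG) cfDprodlK.
split; first exact: resE.
  move=> x /eqP trx; rewrite /coefA dprodl_IirrE.
  (* As [x] has trace zero, phi_x is trivial on scalars, so both characters in the inner product
     come from the SL_n factor of [K m']. *)
  have phi_scalar : {in scalar_group n w m', forall z, phix_fun phi x z = 1}.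
    move=> z /scalar_setP[r _ zr]; rewrite /phix_fun zr -raddfB /= mul_mx_scalar mxtraceZ.
    by rewrite trx mulr0 phi0.
  rewrite (mkCF_dprod dK _ _ phi_scalar); [|exact: phix1|exact: (phixM cR phi_add)].
  rewrite -(cfDprodl_iso dK); congr '[_, _].
  apply/cfun_inP => g Kg; have [_ HZ _ _] := dprodP dK.
  have /mulsgP[h z Kh Zz gE] : g \in (Kgroup n w SLt m' * scalar_group n w m')%g by rewrite HZ.
  rewrite gE cfDprodEl // !cfResE ?subsetIl //; last by rewrite -gE.
  by rewrite cfDprodEl ?(subsetP (scalar_sub n w m'_gt0) z) //; case/setIP: Kh.
(* Otherwise phi_x is nontrivial at some scalar [z] of [K m'], while ['chi_j] is invariant under
   translation by [z]; hence [coefA] vanishes. *)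
move=> x _ xj; apply/eqP; apply: contraR xj => /(phi_nondeg cR phi_prim)[r phi_r].
set j := dprodl_Iirr dG i.
have z1 : (1 + w ^+ m' * r)%:M - 1 = (w ^+ m' * r)%:M :> Mn.
  by rewrite raddfD /= addrAC subrr add0r.
have zm : mx_inI w m' ((1 + w ^+ m' * r)%:M - 1 : Mn).
  by apply/mx_inIP; exists r%:M; rewrite scale_scalar_mx z1.
have [zE Kz] := glmx_Ker cR m'_gt0 zm; set z := glmx _ in zE Kz.
have Zz : z \in scalar_group n w 1.
  apply/scalar_setP; exists (1 + w ^+ m' * r) => //; rewrite addrAC subrr add0r.
  by apply/existsP; exists (w ^+ m'.-1 * r); rewrite mulrA -exprD add1n prednK.
have phi_z : phix_fun phi x z != 1.
  move: phi_r; rewrite /phix_fun zE z1 mul_mx_scalar mxtraceZ.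
  by rewrite mulrA [r * _]mulrC.
have chi_z g : g \in det1_group n w -> 'chi_j (g * z)%g = 'chi_j g.
  have [_ HZ _ _] := dprodP dG => Hg.
  have /mulsgP[h z' SLh Zz' ->] : g \in (Ggroup n R SLt * scalar_group n w 1)%g by rewrite HZ.
  by rewrite -mulgA dprodl_IirrE !cfDprodEl ?groupM.
have : (phix_fun phi x z)^* * coefA w l phi j x == coefA w l phi j x.
  rewrite !(coefAE cR phi_add KG (subset_trans USL SLG)) mulrCA; apply/eqP; congr (_ * _).
  rewrite mulr_sumr [RHS](reindex_inj (mulIg z)) /=; apply: eq_big => [v|v Kv].
    by rewrite groupMr.
  rewrite chi_z ?(subsetP KmG) // (phixM cR phi_add x l2m' Kv Kz) rmorphM; ring.
rewrite -subr_eq0 -{2}[coefA w l phi j x]mul1r -mulrBl mulf_eq0 => /orP[|//].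
by rewrite subr_eq0 -(inj_eq (inv_inj (@conjCK _))) conjCK rmorph1 (negPf phi_z).
Qed.
End Extension.

(** * Regular representations *)

Lemma dvr_quotient_chain_ring (o : idomainType) (varpi : o) (l : nat) (R : finComUnitRingType)
    (f : {rmorphism o -> R}) :
  dvr_uniformizer varpi -> (2 <= l)%N -> (forall y : R, exists x : o, f x = y) ->
  (forall x : o, f x = 0 <-> exists c : o, x = varpi ^+ l * c) -> chain_ring (f varpi) l.
Proof.
case=> varpi0 varpiU factor l_gt1 f_surj f_ker; split=> //.
- by rewrite -rmorphXn; apply/f_ker; exists 1; rewrite mulr1.
(* Otherwise varpi^(l-1) would be a multiple of varpi^l, and varpi a unit. *)
- rewrite -rmorphXn; apply: contra varpiU => /eqP/f_ker[c].
  rewrite -[l in varpi ^+ l * c]prednK ?(ltnW l_gt1) // exprSr -mulrA -[LHS]mulr1.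
  move=> /(mulfI (expf_neq0 _ varpi0)) varpi_c.
  by apply/unitrPr; exists c.
move=> y y0; have [x xy] := f_surj y.
have [|k [u uU xE]] := factor x; first by apply: contra_neq y0 => x0; rewrite -xy x0 rmorph0.
by exists k, (f u); rewrite ?rmorph_unit // -xy xE rmorphM rmorphXn.
Qed.

(** By Bezout some multiple of [n] is congruent to 1 modulo p, hence modulo w. *)
Lemma natr_unit_coprime (R : finComUnitRingType) (w : R) (l n p : nat) :
  chain_ring w l -> prime p -> inI w 1 (p%:R : R) -> ~~ (p %| n)%N ->
  n%:R \is a @GRing.unit R.
Proof.
move=> cR p_pr wp pn; have n_gt0 : (0 < n)%N by case: n pn; rewrite ?dvdn0.
have co_np : gcdn n p = 1%N by apply/eqP; rewrite gcdnC -/(coprime p n) prime_coprime.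
case: (egcdnP p n_gt0) => u v; rewrite co_np => unv _.
have : (u * n)%:R \is a @GRing.unit R.
  apply: (chain_unit1 cR); rewrite unv natrD addrK natrM.
  exact: inIMl.
by rewrite natrM unitrM => /andP[].
Qed.

Section AlphaRegular.
Variables (n : nat) (R : finComUnitRingType) (w : R) (l : nat) (phi : R -> algC).
Hypotheses (n_gt1 : (1 < n)%N).
Hypotheses (cR : chain_ring w l) (phi_add : additive_char phi).
Variable a : R.
Hypothesis aU : a \is a GRing.unit.
Local Notation Mn := 'M[R]_n.-1.+1.
Local Notation m' := (l - l./2)%N.
Implicit Types (c : 'cV[R]_n.-1.+1) (x : Mn).

Lemma alpha_companionE c (i j : 'I_n.-1.+1) : (j < n.-1)%N ->
  alpha_companion a c i j = if (i == 1%N :> nat) && (j == 0%N :> nat) then a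
                       else if ((1 <= j)%N && (i == j.+1 :> nat)) then 1 else 0.
Proof.
move=> jn; rewrite twist_conjE // mxE -val_eqE /= (ltn_eqF jn).
have [ij|ij] := eqVneq (i : nat) j.+1; last first.
  by rewrite andbF mulr0 mul0r; case: andP => // -[/eqP i1 /eqP j0]; rewrite i1 j0 in ij.
rewrite mulr1 /twist_coef -!val_eqE /= ij eqSS andbb andbT.
by case: (j : nat) => [|j'] /=; rewrite ?divr1 ?divrr.
Qed.

Lemma alpha_regular_companion c : @alpha_regular_mod n R w l./2 a (alpha_companion a c).
Proof.
apply/forallP => i; apply/forallP => j; apply/implyP => jn.
by rewrite alpha_companionE // subrr inI0.
Qed.

Lemma alpha_regular_congr x : @alpha_regular_mod n R w l./2 a x ->
  exists c, w ^+ m' *: x = w ^+ m' *: alpha_companion a c.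
Proof.
move=> /forallP xP.
(* The last column of [x], with the effect of conjugation by [twist] undone. *)
exists (\col_i ((twist_coef a (i : 'I_n.-1.+1))^-1 * x i ord_max * twist_coef a (ord_max : 'I_n.-1.+1))).
have tU (i : 'I_n.-1.+1) : twist_coef a i \is a GRing.unit by rewrite /twist_coef; case: eqP; rewrite ?unitr1.
have m_le_l : (l./2 <= l)%N by lia.
apply/matrixP => i j; rewrite [LHS]mxE [RHS]mxE.
have [jn|nj] := ltnP j n.-1; last first.
  have -> : j = ord_max by apply: val_inj; have := ltn_ord j; rewrite /=; lia.
  rewrite twist_conjE // !mxE eqxx; congr (_ * _).
  by rewrite !mulrA mulrV // mul1r mulrK.
have /forallP/(_ j)/implyP/(_ jn) := xP i; set c := \col_i0 _; rewrite -(alpha_companionE c i jn).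
by rewrite (inI_annE cR _ m_le_l) mulrBr subr_eq0 => /eqP.
Qed.

Lemma mxtrace_alpha_companion c : \tr (alpha_companion a c) = c ord_max 0.
Proof.
rewrite mxtrace_mulC mulmxA GLvalVK mul1mx /mxtrace (bigD1 ord_max) //= mxE eqxx.
rewrite big1 ?addr0 // => i im; rewrite mxE (negPf im).
by rewrite ltn_eqF.
Qed.

(** For SL_n a lift of trace exactly zero is required; the trace is the last entry of [c], which may
    be cleared without leaving the class modulo w^m. *)
Lemma alpha_companion_trace0 c : w ^+ m' * \tr (alpha_companion a c) = 0 ->
  exists2 c', \tr (alpha_companion a c') = 0 &
    w ^+ m' *: alpha_companion a c' = w ^+ m' *: alpha_companion a c.
Proof.
rewrite mxtrace_alpha_companion => wc.
exists (\col_i if i == ord_max then 0 else c i 0).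
  by rewrite mxtrace_alpha_companion mxE eqxx.
apply/matrixP => i j; rewrite [LHS]mxE [RHS]mxE !twist_conjE // !mxE.
case: (j == ord_max) => //; case: eqP => // ->.
by rewrite !mulr0 mul0r mulr0 mulrA mulrCA wc mulr0 mul0r.
Qed.

Lemma regular_alpha_companion c : regular_mod w 1 (alpha_companion a c).
Proof.
(* The first basis vector is cyclic: [twist] fixes it, so its successive images are the columns of
   [twist]. *)
exists (delta_mx ord0 0); set M := \matrix_(i, k) _.
have -> : M = GLval (twist n a).
  rewrite twistE //; apply/matrixP => i k; rewrite /M [LHS]mxE -colE [LHS]mxE.
  have -> : alpha_companion a c ^+ k = GLval (twist n a) *m companion c ^+ k *m invmx (GLval (twist n a)).
    rewrite -(@comm_mxX _ _ (companion c) (alpha_companion a c)) ?mulmxK ?GLval_unit //.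
    by rewrite /alpha_companion mulmxKV ?GLval_unit.
  rewrite twist_conjE // companionX_col0 /twist_coef eqxx divr1 !mxE.
  by case: (i == k); rewrite ?mulr1 ?mulr0.
have tU : \det (GLval (twist n a)) \is a GRing.unit by rewrite -unitmxE GLval_unit.
apply/existsP; exists (\det (GLval (twist n a)))^-1.
by rewrite mulrV // subrr inI0.
Qed.
End AlphaRegular.

Lemma cfdot_Res_lin_char_sub (gT : finGroupType) (G H K : {group gT}) (chi : 'CF(G)) (lambda : 'CF(H)) :
  K \subset H -> H \subset G -> chi \is a character -> lambda \is a linear_char ->
  '['Res[H] chi, lambda] != 0 -> '['Res[K] chi, 'Res[K] lambda] != 0.
Proof.
move=> KH HG chi_char lin_lambda; have /irrP[j lambdaE] := lin_char_irr lin_lambda.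
have /irrP[k kE] := lin_char_irr (cfRes_lin_char K lin_lambda).
rewrite kE lambdaE -!irr_consttE -(cfResRes _ KH HG) => jchi.
apply: (constt_Res_trans _ jchi); first by rewrite cfRes_char.
by rewrite -lambdaE kE irr_consttE cfdot_irr eqxx oner_neq0.
Qed.

(** Passes from K^m' down to K^(l-1), where regularity is tested: phi_x restricts to phi_x. *)
Lemma contains_phix_sub (n : nat) (R : finComUnitRingType) (w : R) (l : nat) (phi : R -> algC)
    t (i k : nat) (chi : 'CF(Ggroup n R t)) x :
  chain_ring w l -> additive_char phi -> (l <= i + i)%N -> (i <= k)%N ->
  chi \is a character -> contains_phix w phi i chi x -> contains_phix w phi k chi x.
Proof.
move=> cR phi_add li ik chi_char.
have phiM (j : nat) : (i <= j)%N -> {in Kgroup n w t j &, forall g h,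
    phix_fun phi x (g * h)%g = phix_fun phi x g * phix_fun phi x h}.
  move=> ij g h /setIP[_ Kg] /setIP[_ Kh].
  by apply: (phixM cR phi_add x _ Kg Kh); lia.
have KK : Kgroup n w t k \subset Kgroup n w t i by apply: setIS (Ker_sub n w ik).
rewrite /contains_phix; have <- : 'Res[Kgroup n w t k] (phix w phi t i x) = phix w phi t k x.
  apply/cfun_inP => g Kg; rewrite cfResE // !mkCFE ?phix1 ?Kg ?(subsetP KK) //.
  - exact: phiM.
  - exact: phiM.
apply: (cfdot_Res_lin_char_sub KK) => //; first exact: subsetIl.
by apply: mkCF_lin_char; [apply: phix1 | apply: phiM].
Qed.

Theorem theorem4p2
  (o : idomainType) (varpi : o) (Hvarpi : dvr_uniformizer varpi)
  (l : nat) (Hl : (2 <= l)%N)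
  (R : finComUnitRingType) (f : {rmorphism o -> R})
  (Hfsurj : forall y : R, exists x : o, f x = y)
  (Hfker : forall x : o, f x = 0 <-> exists c : o, x = varpi ^+ l * c)
  (n : nat) (Hn : (2 <= n)%N) (t : GType)
  (HSL : t = SLt -> exists p : nat,
           [/\ prime p, inI (f varpi) 1 (p%:R : R), odd p & ~~ (p %| n)%N])
  (phi : R -> algC) (Hphi : additive_char phi) (Hprim : primitive_char (f varpi) phi l)
  (a : R) (Ha : a \is a GRing.unit) :
  (forall i : Iirr (@Ggroup n R t),
     '['Ind[@Ggroup n R t] (theta n phi a), 'chi_i] != 0 <->
     @alpha_regular_rep n R (f varpi) phi t l a 'chi_i) /\
  (forall i : Iirr (@Ggroup n R t),
     '['Ind[@Ggroup n R t] (theta n phi a), 'chi_i] <= 1).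
Proof.
have cR := dvr_quotient_chain_ring Hvarpi Hl Hfsurj Hfker; set w := f varpi in cR Hprim HSL *.
have nU : t = SLt -> n.-1.+1%:R \is a @GRing.unit R.
  move=> /HSL[p [p_pr wp _ pn]]; rewrite prednK ?(ltnW Hn) //.
  exact: natr_unit_coprime cR p_pr wp pn.
have m_gt0 : (0 < l./2)%N by rewrite half_gt0.
have m_double : (l./2 + l./2 <= l)%N by have := odd_double_half l; lia.
have l2m' : (l <= (l - l./2) + (l - l./2))%N by lia.
have m'_le : (l - l./2 <= l.-1)%N by lia.
have main i := irr_extension cR Hphi Hprim nU i.
have indE (i : Iirr (Ggroup n R t)) : '['Ind (theta n phi a), 'chi_i] =
    ('['Res[U_group n R] 'chi_i, theta n phi a])^*.
  by rewrite -cfdot_Res_r cfdotC.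
split=> i; rewrite indE; have [H [j [KH UH tauH normH [resU cont tr0]]]] := main i;
  rewrite -resU; have wh := whittaker_alpha Hn cR Hphi Hprim Ha KH UH tauH (normH _) j; last first.
  (* At most one model: the multiplicity is 0 or 1 by [whittaker_alpha]. *)
  by case: wh => -[-> _]; rewrite ?conjC1 ?conjC0 ?ler01.
split.
  case: wh => -[-> wh]; last by rewrite conjC0 eqxx.
  move=> _; have [c gx cx] : exists2 c, in_g t (alpha_companion a c)
      & coefA w l phi j (alpha_companion a c) != 0.
    (* For SL_n, [in_g] demands a representative of trace zero in the same class modulo w^m. *)
    case: wh => c cj; case tE: t; first by exists c.
    have [c' tr_c' cc'] := alpha_companion_trace0 Ha (tr0 _ tE cj).
    by exists c'; rewrite /= ?tr_c' // (coefA_congr cR Hphi KH UH j cc').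
  have cphi : contains_phix w phi (l - l./2) 'chi_i (alpha_companion a c).
    by rewrite /contains_phix cont.
  split; exists (alpha_companion a c); split=> //.
  - exact: regular_alpha_companion.
  - exact: contains_phix_sub cR Hphi l2m' m'_le (irr_char i) cphi.
  exact: alpha_regular_companion.
(* Conversely, [x] is congruent modulo w^m to some [alpha_companion a c], which excludes
   multiplicity 0. *)
case=> _ [x [gx xa]]; rewrite /contains_phix cont // => xj.
have [c xc] := alpha_regular_congr Hn cR Ha xa.
case: wh => -[-> wh]; first by rewrite conjC1 oner_neq0.
by rewrite (coefA_congr cR Hphi KH UH j xc) wh eqxx in xj.
Qed.
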